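(* The domain $\Omega_\Psi:=\{(z,w,\zeta)\in\mathbb C^3:\ \operatorname{Re}(\zeta)>\Psi(z,w)\}$, where $\Psi$ is the specific nonnegative plurisubharmonic function on $\mathbb C^2$ constructed in the context, does not admit any strong antipeak function at infinity.
   Context: Strong antipeak function: for an unbounded domain $\Omega\subset\mathbb C^n$, a bounded continuous positive plurisubharmonic function $\varphi$ on $\Omega$ is called strong antipeak at infinity for $\Omega$ if $\lim_{\|z\|\to\infty}\varphi(z)=0$. Notation: $\Delta_r(p)=\{\lambda\in\mathbb C:|\lambda-p|<r\}$; $B^2_R(0)$ is the Euclidean ball of radius $R$ centered at $0$ in $\mathbb C^2$; $\pi_w(z,w)=w$; $e^{-\infty}=0$. Construction of $\Psi$. (1) Lattice points. $\{a_n\}_{n\in\mathbb N}$ enumerates $\mathbb Z+i\mathbb Z$ along the anticlockwise spiral $a_1=0$, $a_2=1$, $a_3=1+i$, $a_4=i$, $a_5=-1+i$, $a_6=-1,\dots$, so that for every $n$ the points of $\mathbb Z+i\mathbb Z$ with $-n\le\operatorname{Re}\zeta,\operatorname{Im}\zeta\le n$ are $a_1,\dots,a_{(2n+1)^2}$. (2) Wermer type set. For positive numbers $\varepsilon_n$ decreasing to $0$, let $E_n=\{(z,w)\in\mathbb C^2:\ w=\sum_{j=1}^n\varepsilon_j\sqrt{z-a_j}\}$ (multivalued: all choices of the square roots) and $\mathcal E=\bigcup_{R>0}\lim_{n\to\infty}\big(E_n\cap\overline{B^2_R(0)}\big)$, with limits in the Hausdorff distance. For $\delta>0$ put $\mathcal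 E^\delta=\bigcup_{(z,w)\in\mathcal E}\{z\}\times\Delta_\delta(w)$. (3) Sets in the $z$-plane. For $n\in\mathbb N$: $S_n$ is the set of $z$ with $-(n+\frac34)\le\operatorname{Re}z,\operatorname{Im}z\le n+\frac34$, minus the set of $z$ with $-(n+\frac14)<\operatorname{Re}z,\operatorname{Im}z<n+\frac14$; $T_n$ is the boundary of the square $\{|\operatorname{Re}z|\le n+\frac12,\ |\operatorname{Im}z|\le n+\frac12\}$; $\tilde S_n$ is the set of $z$ with $-n-2\le\operatorname{Re}z,\operatorname{Im}z\le n+2$, minus the set of $z$ with $-n+1<\operatorname{Re}z,\operatorname{Im}z<n-1$. (4) Choice of $\{\varepsilon_n\}$. The sequence $\{\varepsilon_n\}$ decreases to zero so fast that all of the following hold. (a) It satisfies the decay conditions of the Wermer type set construction of Harz, Shcherbina and Tomassini. In particular the limits in (2) exist, there is a plurisubharmonic function $\phi:\mathbb C^2\to[-\infty,+\infty)$ with $\mathcal E=\{\phi=-\infty\}$ that is pluriharmonic on $\mathbb C^2\setminus\mathcal E$ (fix such a $\phi$), and over each disk $\Delta_{1/4}(p)$, $p\in S_n$, the set $\mathcal E$ is a union of graphs $\{w=f_\lambda(z)\}$, $\lambda\in\mathcal A$, of holomorphic functions, where $\mathcal A$ is a Cantor set. (b) $\alpha(n):=\sup\{|f_\lambda'(z)|:\lambda\in\mathcal A,\ z\in\Delta_{1/8}(p),\ p\in S_n\}$ tends to $0$ as $n\to\infty$. Put $q_0:=\inf\{k\in\mathbb N:\alpha(j)<\frac12\text{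 for all }j\ge k\}$. (c) $\varepsilon_1=1$ and, inductively for $k\ge2$, one chooses $0<r_k<\frac12$ such that $E_{k-1}$ over $\Delta_{r_k}(a_k)$ is the union of the graphs of functions $f^{k-1}_1,\dots,f^{k-1}_{2^{k-1}}$ holomorphic near $\overline{\Delta_{r_k}(a_k)}$ and with pairwise distinct values at every point of $\partial\Delta_{r_k}(a_k)$. One sets $\kappa_k:=\inf_{j\ne l}\{|f^{k-1}_j(z)-f^{k-1}_l(z)|:|z-a_k|=r_k\}>0$ and takes $\varepsilon_k>0$ with $2\varepsilon_k\sqrt{r_k}<\kappa_k/2$ and, for every $2\le p\le k-1$, $2\varepsilon_k\sqrt{|a_k-a_p|+r_p}<\varepsilon_p\sqrt{r_p}/2^{k-p+1}$. Also fix some $r_1\in(0,\frac12)$. (5) The numbers $q(n)$. Let $\kappa(n):=\inf\{\varepsilon_p\sqrt{r_p}/4:\ a_p\in\tilde S_n\}$, and choose $q(n)$ so large that $\{e^{\phi+q(n)}<1\}\cap(\tilde S_n\times\mathbb C)\subset\mathcal E^{\kappa(n)}\cap(\tilde S_n\times\mathbb C)$. (6) The numbers $\tilde q(n)$. For $n\ge q_0$ let $\mathcal H_n$ be the set of holomorphic disks $D=\{(f(w),w):w\in\Delta_1(w_0)\}$ with $(f(w_0),w_0)\in\mathcal E\cap(T_n\times\mathbb C)$ and $|f'|<1$ on $\Delta_1(w_0)$. Let $\frac14D=\{(f(w),w):w\in\Delta_{1/4}(w_0)\}$, let $\beta^\delta(D)$ be the supremum of the diameters of the connected components of the closure of $\pi_w(\frac14D\cap\mathcal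 E^\delta)$, and let $\beta_n^\delta:=\sup_{D\in\mathcal H_n}\beta^\delta(D)$; one has $\lim_{\delta\to0}\beta_n^\delta=0$. For $n>q_0$ let $\delta(n)>0$ be such that $\beta_k^{\delta(n)}\le\frac12$ for all $n-1\le k\le n+2$, and choose $\tilde q(n)\ge q(n)$ such that $\{e^{\phi+\tilde q(n)}<1\}\cap(\tilde S_n\times\mathbb C)\subset\mathcal E^{\delta(n)}\cap(\tilde S_n\times\mathbb C)$. (7) The function $\rho$. Put $c(n)=q(n)+n$ for $n\le q_0$ and $c(n)=\tilde q(n)+n$ for $n>q_0$ (the numbers being chosen so that $c(n)$ is positive and increasing), and let $\rho:[0,+\infty)\to[0,+\infty)$ be a strictly convex $\mathcal C^\infty$ function with $\rho'(0)=0$ and $\rho\ge c(n)$ on $[n-1,n+2]$ for every $n\in\mathbb N$; in particular $\rho(x)\to+\infty$ as $x\to+\infty$. (8) Finally, $\Psi(z,w):=e^{\phi(z,w)+\rho(|\operatorname{Re}(z)|)+\rho(|\operatorname{Im}(z)|)}$. *)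

(* Defs.v *)
(* The complex numbers are R[i], for an arbitrary R : realType. *)
From HB Require Import structures.
From mathcomp Require Import all_boot all_order all_algebra.
From mathcomp Require Import all_classical all_reals all_analysis.
From mathcomp Require Export complex.
Set Implicit Arguments.
Unset Strict Implicit.
Unset Printing Implicit Defensive.
Import Order.TTheory GRing.Theory Num.Theory numFieldNormedType.Exports.
Import ComplexField.Normc.
Local Open Scope classical_set_scope.
Local Open Scope ring_scope.
Local Open Scope complex_scope.

(* R[i] carries the topology and norm of any numFieldType, but only under the
   alias R[i]^o; this is the same transfer that numFieldNormedType does for R.
   [derivable] and [derive1] on R[i] are then complex derivatives. *)
#[export, non_forgetful_inheritance]
HB.instance Definition _ (R : realType) := NormedModule.copy R[i] R[i]^o.

Section PotentialTheory.
Context {R : realType}.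
Local Notation C := R[i].

Definition disc (p : C) (r : R) : set C := [set z | normc (z - p) < r].

Definition cdisc (p : C) (r : R) : set C := [set z | normc (z - p) <= r].

Definition holomorphic_on (U : set C) (f : C -> C) :=
  forall z, U z -> derivable f z 1.

Definition upper_semicontinuous_on (T : topologicalType) (U : set T)
    (u : T -> \bar R) :=
  forall x, U x -> forall c : R, (u x < c%:E)%E ->
    \forall y \near within U (nbhs x), (u y < c%:E)%E.

Definition circle_pt (a : C) (r t : R) : C :=
  a + r%:C * (cos t +i* sin t).

(* The integral makes sense: an upper semicontinuous u < +oo is bounded above
   on the circle.  The function -oo is allowed. *)
Definition subharmonic (U : set C) (u : C -> \bar R) :=
  [/\ forall z, U z -> (u z < +oo)%E,
      upper_semicontinuous_on U u &
      forall (a : C) (r : R), 0 < r -> cdisc a r `<=` U ->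
        (u a <= ((2 * pi)^-1)%:E *
           \int[@lebesgue_measure R]_(t in `[0%R, (2 * pi)%R])
             u (circle_pt a r t))%E].

Definition plurisubharmonic (V : normedModType C) (U : set V)
    (u : V -> \bar R) :=
  [/\ forall x, U x -> (u x < +oo)%E,
      upper_semicontinuous_on U u &
      forall a b : V,
        subharmonic [set l : C | U (a + l *: b)] (fun l => u (a + l *: b))].

(* Derivative of u in the real direction v. *)
Definition dirder (V : normedModType C) (u : V -> R) (v p : V) : R :=
  derive1 (fun t : R => u (p + t%:C *: v)) 0.

(* U is open and V finite-dimensional: continuous directional derivatives then
   amount to being continuously (real-)differentiable. *)
Definition C1_on (V : normedModType C) (U : set V) (u : V -> R) :=
  forall v p, U p ->
    derivable (fun t : R => u (p + t%:C *: v)) 0 1 /\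
    {for p, continuous (dirder u v)}.

Definition C2_on (V : normedModType C) (U : set V) (u : V -> R) :=
  C1_on U u /\ forall v, C1_on U (dirder u v).

(* C^2, and the Laplacian of l |-> u (p + l b) vanishes for all p and b. *)
Definition pluriharmonic (V : normedModType C) (U : set V) (u : V -> R) :=
  C2_on U u /\
  forall p b, U p ->
    dirder (dirder u b) b p + dirder (dirder u ('i *: b)) ('i *: b) p = 0.

Definition cnorm n (z : 'rV[C]_n) : R :=
  Num.sqrt (\sum_(i < n) normc (z 0 i) ^+ 2).

Definition strong_antipeak n (Omega : set 'rV[C]_n) (u : 'rV[C]_n -> R) :=
  [/\ [bounded u z | z in Omega],
      {within Omega, continuous u},
      forall z, Omega z -> 0 < u z,
      plurisubharmonic Omega (EFin \o u) &
      forall e : R, 0 < e -> exists M : R,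
        forall z, Omega z -> M < cnorm z -> `|u z| < e].

End PotentialTheory.

Section HausdorffLimit.
Context {R : realType}.
Local Notation C := R[i].
Local Notation C2 := (C * C)%type.

Definition cnorm2 (p : C2) : R :=
  Num.sqrt (normc p.1 ^+ 2 + normc p.2 ^+ 2).

Definition cball2 (r : R) : set C2 := [set p | cnorm2 p <= r].

Definition fattening (A : set C2) (d : R) : set C2 :=
  [set p | exists2 q, A q & cnorm2 (p - q) < d].

(* 0 between two empty sets, +oo between an empty set and a nonempty one. *)
Definition hausdorff_dist (A B : set C2) : \bar R :=
  ereal_inf [set d%:E | d in
    [set d : R | [/\ 0 < d, A `<=` fattening B d & B `<=` fattening A d]]].

Definition hausdorff_limit (A : nat -> set C2) (L : set C2) :=
  compact L /\ hausdorff_dist (A n) L @[n --> \oo] --> 0%E.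

End HausdorffLimit.

(* The anticlockwise square spiral 0, 1, 1+i, i, -1+i, -1, -1-i, -i, 1-i, 2-i,
   2, 2+i, ...; the step from (x, y) is right, up, left or down according to the
   side of the square max(|x|, |y|) = m on which (x, y) lies. *)
Definition spiral_step (p : int * int) : int * int :=
  let m := Num.max `|p.1| `|p.2| in
  if p.2 == - m then (p.1 + 1, p.2)
  else if (p.1 == m) && (p.2 < m) then (p.1, p.2 + 1)
  else if (p.2 == m) && (- m < p.1) then (p.1 - 1, p.2)
  else (p.1, p.2 - 1).

Section Construction.
Context {R : realType}.
Local Notation C := R[i].
Local Notation C2 := (C * C)%type.

(* All sequences below are indexed by n >= 1; their value at 0 is irrelevant. *)
Definition lattice_pt (n : nat) : C :=
  let p := iter n.-1 spiral_step (0, 0) in (p.1)%:~R +i* (p.2)%:~R.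

Local Notation a := lattice_pt.

Definition E_ (eps : nat -> R) (n : nat) : set C2 :=
  [set p | exists s : nat -> C,
    (forall j, (1 <= j <= n)%N -> s j ^+ 2 = p.1 - a j) /\
    p.2 = \sum_(1 <= j < n.+1) (eps j)%:C * s j].

(* The fast decay of eps enters through its consequences: these limits exist,
   wermer_set eps is the -oo set of a plurisubharmonic function, it is locally
   a union of graphs ([graph_family]), and [inductive_choice]. *)
Definition wermer_limits_exist (eps : nat -> R) :=
  forall r : R, 0 < r ->
    exists L, hausdorff_limit (fun n => E_ eps n `&` cball2 r) L.

Definition wermer_set (eps : nat -> R) : set C2 :=
  [set p | exists (r : R) (L : set C2),
    [/\ 0 < r, hausdorff_limit (fun n => E_ eps n `&` cball2 r) L & L p]].

Definition vfattening (E : set C2) (d : R) : set C2 :=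
  [set p | exists2 w, E (p.1, w) & disc w d p.2].

Definition over (U : set C) : set C2 := [set p | U p.1].

Definition graph_over (U : set C) (f : C -> C) : set C2 :=
  [set p | U p.1 /\ p.2 = f p.1].

Definition csquare (s : R) : set C :=
  [set z | - s <= complex.Re z <= s /\ - s <= complex.Im z <= s].

Definition osquare (s : R) : set C :=
  [set z | - s < complex.Re z < s /\ - s < complex.Im z < s].

Definition S_ (n : nat) : set C :=
  csquare (n%:R + 3 / 4) `\` osquare (n%:R + 1 / 4).

Definition T_ (n : nat) : set C :=
  closure (csquare (n%:R + 1 / 2)) `\` interior (csquare (n%:R + 1 / 2)).

Definition tS_ (n : nat) : set C :=
  csquare (n%:R + 2) `\` osquare (n%:R - 1).

Definition decreasing_to0 (eps : nat -> R) :=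
  [/\ forall n, (1 <= n)%N -> 0 < eps n,
      forall m n, (1 <= m <= n)%N -> eps n <= eps m &
      eps n @[n --> \oo] --> 0].

(* Functions F p l, l in A, whose graphs fill E over the disc of radius 1/4
   around p, for every p in a set S_ n (these sets are pairwise disjoint). *)
Definition graph_family (E : set C2) (A : Type) (F : C -> A -> C -> C) :=
  forall n p, (1 <= n)%N -> S_ n p ->
    (forall l, holomorphic_on (disc p (1 / 4)) (F p l)) /\
    E `&` over (disc p (1 / 4)) =
      \bigcup_(l in [set: A]) graph_over (disc p (1 / 4)) (F p l).

Definition alpha (A : Type) (F : C -> A -> C -> C) (n : nat) : \bar R :=
  ereal_sup [set x | exists p l z,
    [/\ S_ n p, disc p (1 / 8) z & x = (normc (derive1 (F p l) z))%:E]].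

Definition is_q0 (al : nat -> \bar R) (q0 : nat) :=
  let good k := (1 <= k)%N /\
    forall j, (k <= j)%N -> (al j < (1 / 2)%:E)%E in
  good q0 /\ forall k, good k -> (q0 <= k)%N.

(* g k j, for j < 2^(k-1), are the branches of E_ (k-1) near the k-th lattice
   point. *)
Definition kappa_branch (r : nat -> R) (g : forall k, 'I_(2 ^ k.-1) -> C -> C)
    (k : nat) : R :=
  inf [set x | exists j l z,
    [/\ j != l, normc (z - a k) = r k & x = normc (g k j z - g k l z)]].

Definition inductive_choice (eps r : nat -> R)
    (g : forall k, 'I_(2 ^ k.-1) -> C -> C) :=
  [/\ eps 1%N = 1, 0 < r 1%N < 1 / 2 &
  forall k, (2 <= k)%N ->
  [/\ 0 < r k < 1 / 2,
      [/\ exists U, [/\ open U, cdisc (a k) (r k) `<=` U &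
            forall j, holomorphic_on U (g k j)],
          E_ eps k.-1 `&` over (disc (a k) (r k)) =
            \bigcup_(j in [set: 'I_(2 ^ k.-1)])
              graph_over (disc (a k) (r k)) (g k j) &
          forall z j l, normc (z - a k) = r k -> j != l ->
            g k j z != g k l z],
      0 < kappa_branch r g k,
      2 * eps k * Num.sqrt (r k) < kappa_branch r g k / 2 &
      forall p, (2 <= p <= k.-1)%N ->
        2 * eps k * Num.sqrt (normc (a k - a p) + r p)
          < eps p * Num.sqrt (r p) / 2 ^+ (k - p + 1)]].

Definition kappa_strip (eps r : nat -> R) (n : nat) : R :=
  inf [set x | exists p,
    [/\ (1 <= p)%N, tS_ n (a p) & x = eps p * Num.sqrt (r p) / 4]].

(* {e^(phi + q) < 1} over tS_ n lies in the d-fattening of E. *)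
Definition sublevel_in_fattening (phi : C2 -> \bar R) (E : set C2)
    (n : nat) (q d : R) :=
  [set p | (expeR (phi p + q%:E) < 1)%E] `&` over (tS_ n)
    `<=` vfattening E d `&` over (tS_ n).

(* The disc {(f w, w) : |w - w0| < 1} is represented by the pair w0, f. *)
Definition H_ (E : set C2) (n : nat) (w0 : C) (f : C -> C) :=
  [/\ holomorphic_on (disc w0 1) f,
      E (f w0, w0), T_ n (f w0) &
      forall w, disc w0 1 w -> normc (derive1 f w) < 1].

Definition quarter_disk (w0 : C) (f : C -> C) : set C2 :=
  [set p | disc w0 (1 / 4) p.2 /\ p.1 = f p.2].

Definition diam (K : set C) : \bar R :=
  ereal_sup [set x | exists y z, [/\ K y, K z & x = (normc (y - z))%:E]].

Definition beta_disk (E : set C2) (d : R) (w0 : C) (f : C -> C) : \bar R :=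
  let K := closure (snd @` (quarter_disk w0 f `&` vfattening E d)) in
  ereal_sup [set diam (connected_component K w) | w in K].

Definition beta (E : set C2) (n : nat) (d : R) : \bar R :=
  ereal_sup [set x | exists w0 f, H_ E n w0 f /\ x = beta_disk E d w0 f].

Definition c_ (q0 : nat) (q qt : nat -> R) (n : nat) : R :=
  (if (n <= q0)%N then q n else qt n) + n%:R.

(* Smoothness on the closed half-line is that of some extension h to R. *)
Definition convex_weight (c : nat -> R) (rho : R -> R) :=
  [/\ forall x, 0 <= x -> 0 <= rho x,
      forall x y t, 0 <= x -> 0 <= y -> x != y -> 0 < t < 1 ->
        rho (t * x + (1 - t) * y) < t * rho x + (1 - t) * rho y,
      exists h : R -> R,
        [/\ forall x, 0 <= x -> rho x = h x,
            forall k x, derivable (derive1n k h) x 1 &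
            derive1 h 0 = 0] &
      forall n x, (1 <= n)%N -> n%:R - 1 <= x <= n%:R + 2 -> c n <= rho x].

Definition Psi (phi : C2 -> \bar R) (rho : R -> R) (p : C2) : \bar R :=
  expeR (phi p + (rho `|complex.Re p.1|)%:E + (rho `|complex.Im p.1|)%:E)%E.

Definition Omega_Psi (phi : C2 -> \bar R) (rho : R -> R) : set 'rV[C]_3 :=
  [set p : 'rV[C]_3 |
    let zw := (p 0 0, p 0 1) in let zeta := p 0 ord_max in
    (Psi phi rho zw < (complex.Re zeta)%:E)%E].

End Construction.

(* Main.v *)
Require Import Defs.
From mathcomp Require Import all_boot all_order all_algebra.
From mathcomp Require Import all_classical all_reals all_analysis.
From mathcomp Require Import ring lra.
Import Order.TTheory GRing.Theory Num.Theory numFieldNormedType.Exports.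
Local Open Scope classical_set_scope.
Local Open Scope ring_scope.
Local Open Scope complex_scope.

(** Let E be the pole set {phi = -oo}; on E the function Psi vanishes, so
    v(z, w) = u(z, w, 1) is defined, continuous and submean on complex lines
    near E, positive, and it tends to 0 at infinity, for any strong antipeak
    function u.  The set E behaves like a complex curve: the maximum of v on E over
    a ball is attained on the sphere.  As v is small on large spheres, this
    contradicts the positivity of v on E.

    The maximum principle is proved by penalization, using only the complex lines
    of the definition of plurisubharmonicity.  With Q = |z|^2 + |w|^2, consider
      W = v + delta Q + eta phi - lambda e^phi.
    The term eta phi keeps the maximum points of W away from E, the term
    lambda e^phi keeps them close to E, and the smallness of v for Q = m keeps
    them inside the ball {Q <= m}.  So W has a local maximum at a point x outside
    E, where phi is pluriharmonic ([no_antipeak_boundary_pole]).  There is a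
    direction b <> 0 in which the complex differential of phi vanishes at x
    ([critical_direction]); along the line x + C b the second order part of phi is
    a harmonic quadratic form ([C2_critical_line]), which a circle averages to 0,
    while delta Q contributes a strictly positive mean.  Hence the mean of v over
    a small circle around x in that line is less than v x, against the submean
    inequality ([penalized_no_local_max]).

    The argument starts from a boundary point of E.  The set E is closed, being
    made of Hausdorff limits of the E_n on balls ([wermer_set_closed]), and it is
    nonempty, so it has one unless E = C^2; in that case u tends to 0 along a
    whole complex line, and the submean inequality on large circles of this line
    concludes ([no_antipeak_slice]). *)

Section AntipeakTheory.
Set Implicit Arguments.
Unset Strict Implicit.
Unset Printing Implicit Defensive.
Import ComplexField.Normc.

(** * The norm topology of C^2 *)

Section Topology.
Context {R : realType}.
Local Notation C := R[i].
Local Notation C2 := (C * C)%type.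

Lemma normr_normc (z : C) : `|z| = (normc z)%:C.
Proof. by case: z. Qed.

Lemma normc_ge0 (z : C) : 0 <= normc z.
Proof. by case: z => a b; exact: sqrtr_ge0. Qed.

Lemma normc_real (x : R) : normc x%:C = `|x|.
Proof. by rewrite /= expr0n addr0 sqrtr_sqr. Qed.

Lemma Re_le_normc (z : C) : `|complex.Re z| <= normc z.
Proof.
case: z => a b; rewrite -sqrtr_sqr; apply: ler_wsqrtr.
by rewrite lerDl sqr_ge0.
Qed.

Lemma Im_le_normc (z : C) : `|complex.Im z| <= normc z.
Proof.
case: z => a b; rewrite -sqrtr_sqr; apply: ler_wsqrtr.
by rewrite lerDr sqr_ge0.
Qed.

Lemma nbhs_normcP (z : C) (P : set C) :
  nbhs z P <-> exists2 d : R, 0 < d & forall y, normc (y - z) < d -> P y.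
Proof.
split.
  move=> /nbhs_ballP[[d d']] /= /[!ltcE]/= /andP[/eqP -> d0] dP.
  exists d => // y yz; apply: dP.
  by rewrite /ball /= distrC normr_normc ltcR.
move=> [d d0 dP]; apply/nbhs_ballP; exists d%:C => /=; first by rewrite ltcR.
by move=> y; rewrite /ball /= distrC normr_normc ltcR => /dP.
Qed.

(** The l^1 norm of C^2, real valued: neighbourhoods in C^2 are handled through
    its balls. *)
Definition sumnorm (x : C2) : R := normc x.1 + normc x.2.

Lemma nbhs_sumnormP (x : C2) (P : set C2) :
  nbhs x P <-> exists2 d : R, 0 < d & forall y, sumnorm (y - x) < d -> P y.
Proof.
split.
  move=> [[U V]] /= [/nbhs_normcP[d d0 dU] /nbhs_normcP[e e0 eV]] UVP.
  exists (Num.min d e); first by rewrite lt_min d0.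
  move=> y; rewrite lt_min => /andP[yd ye]; apply: UVP; split => /=.
    by apply: dU; apply: le_lt_trans yd; rewrite lerDl normc_ge0.
  by apply: eV; apply: le_lt_trans ye; rewrite lerDr normc_ge0.
move=> [d d0 dP].
exists ([set y | normc (y - x.1) < d / 2], [set y | normc (y - x.2) < d / 2]).
  by split; apply/nbhs_normcP; exists (d / 2) => //; rewrite divr_gt0.
move=> y /= [y1 y2]; apply: dP; rewrite /sumnorm /=; lra.
Qed.

Lemma sumnorm_ge0 x : 0 <= sumnorm x.
Proof. by rewrite addr_ge0// normc_ge0. Qed.

Lemma sumnormD x y : sumnorm (x + y) <= sumnorm x + sumnorm y.
Proof.
rewrite /sumnorm /=; have := le_normcD x.1 y.1; have := le_normcD x.2 y.2; lra.
Qed.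

Lemma sumnormN x : sumnorm (- x) = sumnorm x.
Proof. by rewrite /sumnorm /= !normcN. Qed.

Lemma sumnormB x y : sumnorm (x - y) = sumnorm (y - x).
Proof. by rewrite -sumnormN opprB. Qed.

Lemma sumnormZ l x : sumnorm (l *: x) = normc l * sumnorm x.
Proof. by rewrite /sumnorm /= !normcM mulrDr. Qed.

Lemma sumnorm0 : sumnorm 0 = 0.
Proof. by rewrite /sumnorm /= expr0n /= addr0 sqrtr0 addr0. Qed.

Lemma nbhs_realP (x : R) (P : set R) :
  nbhs x P <-> exists2 d : R, 0 < d & forall y, `|y - x| < d -> P y.
Proof.
split.
  move=> /nbhs_ballP[d /= d0 dP]; exists d => // y yx; apply: dP.
  by rewrite /ball /= distrC.
move=> [d d0 dP]; apply/nbhs_ballP; exists d => //= y.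
by rewrite /ball /= distrC => /dP.
Qed.


Lemma continuous_complex (T : topologicalType) (f g : T -> R) :
  continuous f -> continuous g -> continuous (fun t => f t +i* g t).
Proof.
move=> cf cg t P /nbhs_normcP[d d0 dP].
have d20 : 0 < d / 2 by rewrite divr_gt0.
have hf : \forall s \near t, ball (f t) (d / 2) (f s).
  exact: cf t _ (nbhsx_ballx (f t) _ d20).
have hg : \forall s \near t, ball (g t) (d / 2) (g s).
  exact: cg t _ (nbhsx_ballx (g t) _ d20).
suff : \forall s \near t, P (f s +i* g s) by [].
near=> s.
have : ball (f t) (d / 2) (f s) by near: s.
have : ball (g t) (d / 2) (g s) by near: s.
rewrite /ball /= (distrC (f t)) (distrC (g t)) => gs fs.
apply: (dP (f s +i* g s)).
rewrite [_ - _ : C](_ : _ = (f s - f t)%:C + (g s - g t)%:C * 'i).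
  apply: le_lt_trans (le_normcD _ _) _; rewrite normcM !normc_real.
  rewrite (_ : normc 'i = 1) ?mulr1; last by rewrite /= expr0n expr1n add0r sqrtr1.
  by rewrite (splitr d) ltrD.
by apply/eqP; rewrite eq_complex /=; apply/andP; split; apply/eqP; ring.
Unshelve. all: by end_near. Qed.


End Topology.

(** * Maxima on closed bounded subsets of C^2 *)

Section Extrema.
Context {R : realType}.
Local Notation C := R[i].
Local Notation C2 := (C * C)%type.
Implicit Types (A U : set C2) (x y p q b : C2).

Lemma open_sumnormP A :
  (forall x, A x -> exists2 d : R, 0 < d & forall y, sumnorm (y - x) < d -> A y) ->
  open A.
Proof. by move=> Ad; rewrite openE => x /Ad h; apply/nbhs_sumnormP. Qed.

Lemma open_sumnorm_ball A x : open A -> A x ->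
  exists2 d : R, 0 < d & forall y, sumnorm (y - x) < d -> A y.
Proof. by move=> oA Ax; apply/nbhs_sumnormP; exact: open_nbhs_nbhs. Qed.

(** The square of the Euclidean norm of C^2. *)
Definition sqnorm x : R := complex.Re x.1 ^+ 2 + complex.Im x.1 ^+ 2 +
  (complex.Re x.2 ^+ 2 + complex.Im x.2 ^+ 2).

(** The closed cube of R^4 = C^2 of half-side M. *)
Definition box (M : R) : set C2 := [set x | [/\ `|complex.Re x.1| <= M,
  `|complex.Im x.1| <= M, `|complex.Re x.2| <= M & `|complex.Im x.2| <= M]].

Lemma compact_box M : compact (box M).
Proof.
pose I := (`[- M, M]%classic : set R).
have cI : compact I by exact: segment_compact.
pose f := fun x : (R * R) * (R * R) => (x.1.1 +i* x.1.2, x.2.1 +i* x.2.2) : C2.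
have cf : continuous f.
  have fstc (S T : topologicalType) : continuous (@fst S T) by move=> z; exact: cvg_fst.
  have sndc (S T : topologicalType) : continuous (@snd S T) by move=> z; exact: cvg_snd.
  have c1 : continuous (fun x : (R * R) * (R * R) => x.1.1 +i* x.1.2).
    refine (@continuous_complex R ((R * R) * (R * R))%type (fun w => w.1.1) (fun w => w.1.2) _ _).
    - by move=> y; apply: (continuous_comp (@fstc _ _ y) (@fstc R R _)).
    - by move=> y; apply: (continuous_comp (@fstc _ _ y) (@sndc R R _)).
  have c2 : continuous (fun x : (R * R) * (R * R) => x.2.1 +i* x.2.2).
    refine (@continuous_complex R ((R * R) * (R * R))%type (fun w => w.2.1) (fun w => w.2.2) _ _).
    - by move=> y; apply: (continuous_comp (@sndc _ _ y) (@fstc R R _)).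
    - by move=> y; apply: (continuous_comp (@sndc _ _ y) (@sndc R R _)).
  by move=> x; exact: (cvg_pair (c1 x) (c2 x)).
have -> : box M = f @` ((I `*` I) `*` (I `*` I)).
  apply/seteqP; split.
    move=> [[a b] [c d]] [/= a1 b1 c1 d1]; exists ((a, b), (c, d)) => //=.
    by rewrite /I /= !in_itv /= -!ler_norml.
  move=> _ [[[a b] [c d]] /= [[/= + +] [/= + +]] <-].
  by rewrite /I /= !in_itv /= -!ler_norml.
apply: continuous_compact; first exact: continuous_subspaceT.
by do 2?apply: compact_setX.
Qed.

Lemma sqnorm_box x m : sqnorm x <= m -> box (m + 1) x.
Proof.
rewrite /sqnorm /box /= => xm.
have sq1 (t : R) : `|t| <= t ^+ 2 + 1.
  by rewrite -(real_normK (num_real t)); have := sqr_ge0 (`|t| - 1); have := normr_ge0 t; nra.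
have := sqr_ge0 (complex.Re x.1); have := sqr_ge0 (complex.Im x.1).
have := sqr_ge0 (complex.Re x.2); have := sqr_ge0 (complex.Im x.2).
have := sq1 (complex.Re x.1); have := sq1 (complex.Im x.1).
have := sq1 (complex.Re x.2); have := sq1 (complex.Im x.2).
move: xm; move: (complex.Re x.1) (complex.Im x.1) (complex.Re x.2) (complex.Im x.2).
move=> a b c d; move: `|a| `|b| `|c| `|d| (a ^+ 2) (b ^+ 2) (c ^+ 2) (d ^+ 2).
by move=> a1 b1 c1 d1 a2 b2 c2 d2 *; split; lra.
Qed.

Lemma sqnorm_continuous x (e : R) : 0 < e ->
  exists2 d : R, 0 < d & forall y, sumnorm (y - x) < d -> `|sqnorm y - sqnorm x| < e.
Proof.
move=> e0.
pose K := 1 + 2 * (`|complex.Re x.1| + `|complex.Im x.1| + `|complex.Re x.2| + `|complex.Im x.2|).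
have K0 : 1 <= K by rewrite /K lerDl mulr_ge0// !addr_ge0.
exists (Num.min 1 (e / (4 * K))); first by rewrite lt_min ltr01 divr_gt0//; nra.
move=> y; rewrite lt_min => /andP[yx1]; rewrite ltr_pdivlMr; last by nra.
move=> yx.
have n1 : normc (y - x).1 <= sumnorm (y - x) by rewrite lerDl normc_ge0.
have n2 : normc (y - x).2 <= sumnorm (y - x) by rewrite lerDr normc_ge0.
have a1 := le_trans (Re_le_normc _) n1; have b1 := le_trans (Im_le_normc _) n1.
have a2 := le_trans (Re_le_normc _) n2; have b2 := le_trans (Im_le_normc _) n2.
have S0 := sumnorm_ge0 (y - x).
have sq (s t k S : R) : `|s - t| <= S -> 2 * `|t| <= k - 1 -> 0 <= S -> S < 1 ->
    `|s ^+ 2 - t ^+ 2| <= S * k.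
  move=> h1 h2 h3 h4.
  have -> : s ^+ 2 - t ^+ 2 = (s - t) * (s + t) by ring.
  rewrite normrM ler_pM//.
  have -> : s + t = (s - t) + (t + t) by ring.
  apply: le_trans (ler_normD _ _) _; have := ler_normD t t; lra.
have e1 : 0 <= `|complex.Re x.1| by []. have e2 : 0 <= `|complex.Im x.1| by [].
have e3 : 0 <= `|complex.Re x.2| by []. have e4 : 0 <= `|complex.Im x.2| by [].
have {}a1 : `|complex.Re y.1 ^+ 2 - complex.Re x.1 ^+ 2| <= sumnorm (y - x) * K.
  apply: sq => //; first by move: a1; case: (y) (x) => [[? ?] ?] [[? ?] ?].
  by rewrite /K; lra.
have {}b1 : `|complex.Im y.1 ^+ 2 - complex.Im x.1 ^+ 2| <= sumnorm (y - x) * K.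
  apply: sq => //; first by move: b1; case: (y) (x) => [[? ?] ?] [[? ?] ?].
  by rewrite /K; lra.
have {}a2 : `|complex.Re y.2 ^+ 2 - complex.Re x.2 ^+ 2| <= sumnorm (y - x) * K.
  apply: sq => //; first by move: a2; case: (y) (x) => [? [? ?]] [? [? ?]].
  by rewrite /K; lra.
have {}b2 : `|complex.Im y.2 ^+ 2 - complex.Im x.2 ^+ 2| <= sumnorm (y - x) * K.
  apply: sq => //; first by move: b2; case: (y) (x) => [? [? ?]] [? [? ?]].
  by rewrite /K; lra.
have -> : sqnorm y - sqnorm x =
  (complex.Re y.1 ^+ 2 - complex.Re x.1 ^+ 2) + (complex.Im y.1 ^+ 2 - complex.Im x.1 ^+ 2)
  + (complex.Re y.2 ^+ 2 - complex.Re x.2 ^+ 2) + (complex.Im y.2 ^+ 2 - complex.Im x.2 ^+ 2).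
  rewrite /sqnorm; ring.
apply: le_lt_trans (ler_normD _ _) _.
apply: le_lt_trans (lerD (ler_normD _ _) (lexx _)) _.
apply: le_lt_trans (lerD (lerD (ler_normD _ _) (lexx _)) (lexx _)) _.
lra.
Qed.

Lemma cvg_within_sumnorm A (f : C2 -> R) x :
  (forall e : R, 0 < e -> exists2 d : R, 0 < d &
     forall y, A y -> sumnorm (y - x) < d -> `|f y - f x| < e) ->
  f y @[y --> within A (nbhs x)] --> f x.
Proof.
move=> cf P /nbhs_realP[e e0 eP]; have [d d0 df] := cf e e0.
suff : \forall y \near x, A y -> P (f y) by [].
by apply/nbhs_sumnormP; exists d => // y yx Ay; apply/eP/df.
Qed.

(** The third hypothesis says that A is closed. *)
Lemma attains_max A (m : R) (W : C2 -> R) :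
  A !=set0 -> (forall x, A x -> sqnorm x <= m) ->
  (forall x, ~ A x -> exists2 d : R, 0 < d & forall y, sumnorm (y - x) < d -> ~ A y) ->
  (forall x, A x -> W y @[y --> within A (nbhs x)] --> W x) ->
  exists2 x, A x & forall y, A y -> W y <= W x.
Proof.
move=> A0 Am clA cW.
have cA : compact A.
  apply: (subclosed_compact _ (@compact_box (m + 1))).
    by rewrite -openC; apply: open_sumnormP => x; exact: clA.
  by move=> x /Am; exact: sqnorm_box.
have cWA : {within A, continuous W} by apply/subspace_continuousP.
have [x xA xmax] := compact_EVT_max A0 cA cWA.
by exists x => [|y Ay]; [exact: set_mem|apply: xmax; exact: mem_set].
Qed.

End Extrema.

(** * Functions of one real variable *)

Section RealCalculus.
Context {R : realType}.
Local Notation C := R[i].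
Local Notation C2 := (C * C)%type.

(** The mean value theorem on the segment between 0 and x, for x of any sign. *)
Lemma mean_value_from0 (f : R -> R) (x : R) :
  (forall s, `|s| <= `|x| -> derivable f s 1) ->
  exists2 s, `|s| <= `|x| & f x - f 0 = derive1 f s * x.
Proof.
move=> df.
have cf a b : (forall s, s \in `[a, b] -> `|s| <= `|x|) ->
    {within `[a, b], continuous f}.
  move=> ab; apply: derivable_within_continuous => s /ab; exact: df.
have isd (s : R) : `|s| <= `|x| -> is_derive (s : R^o) (1 : R^o) f (derive1 f s).
  by move=> /df fs; rewrite derive1E; exact: derivableP.
have [x0|x0] := leP 0 x.
  have sub s : s \in `[0, x] -> `|s| <= `|x|.
    by rewrite in_itv /= => /andP[s0 sx]; rewrite !ger0_norm.
  have [|s /sub s0x ->] := @MVT_segment _ f (derive1 f) _ _ x0 _ (cf _ _ sub).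
    by move=> s sx; apply/isd/sub; move: sx; rewrite !in_itv/= => /andP[/ltW-> /ltW].
  by exists s => //; rewrite subr0.
have sub s : s \in `[x, 0] -> `|s| <= `|x|.
  by rewrite in_itv /= => /andP[s0 sx]; rewrite !ler0_norm ?lerN2//; exact: ltW.
have [|s /sub s0x fE] := @MVT_segment _ f (derive1 f) _ _ (ltW x0) _ (cf _ _ sub).
  by move=> s sx; apply/isd/sub; move: sx; rewrite !in_itv/= => /andP[/ltW-> /ltW].
by exists s => //; rewrite -[LHS]opprB fE sub0r mulrN opprK.
Qed.

Lemma derive_shift (f : R -> R) (s : R) :
  (derivable f s 1 <-> derivable (fun t => f (t + s)) 0 1)
  /\ derive1 f s = derive1 (fun t => f (t + s)) 0.
Proof.
have E : (fun h : R => h^-1 *: ((f \o shift s) (h *: 1) - f s))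
  = (fun h => h^-1 *: (((fun t => f (t + s)) \o shift 0) (h *: 1) - f (0 + s))).
  by apply/funext => h /=; rewrite !addr0 add0r.
split; first by rewrite /derivable E.
have E2 : (fun h : R => h^-1 *: (f (h + s) - f s))
  = (fun h => h^-1 *: (f (h + 0 + s) - f (0 + s))).
  by apply/funext => h; rewrite addr0 add0r.
by rewrite /derive1 E2.
Qed.

End RealCalculus.

(** * Directional derivatives and Taylor expansions *)

Section DirectionalCalculus.
Context {R : realType}.
Local Notation C := R[i].
Local Notation C2 := (C * C)%type.
Implicit Types (u : C2 -> R) (U : set C2) (p q v : C2).

Lemma dirder_along u v p (s : R) :
  (derivable (fun t : R => u (p + t%:C *: v)) s 1 <->
   derivable (fun t : R => u (p + s%:C *: v + t%:C *: v)) 0 1) /\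
  derive1 (fun t : R => u (p + t%:C *: v)) s = dirder u v (p + s%:C *: v).
Proof.
have E : (fun t : R => u (p + (t + s)%:C *: v)) =
         (fun t : R => u (p + s%:C *: v + t%:C *: v)).
  by apply/funext => t; rewrite rmorphD scalerDl addrA addrAC.
rewrite /dirder -E; exact: (derive_shift (fun t : R => u (p + t%:C *: v)) s).
Qed.

Lemma near_line p q v (s : R) d : sumnorm (q - p) < d / (2 + sumnorm v) ->
  `|s| < d / (2 + sumnorm v) -> sumnorm (q + s%:C *: v - p) < d.
Proof.
have n0 := sumnorm_ge0 v; have k0 : 0 < 2 + sumnorm v by lra.
rewrite !ltr_pdivlMr// => qp sd.
rewrite addrAC; apply: le_lt_trans (sumnormD _ _) _.
rewrite sumnormZ normc_real.
have := sumnorm_ge0 (q - p); have := normr_ge0 s.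
nra.
Qed.

(** First order expansion along v, uniform in the base point q near p. *)
Lemma C1_step U u p v e : open U -> U p -> C1_on U u -> 0 < e ->
  exists2 d, 0 < d & forall q (s : R), sumnorm (q - p) < d -> `|s| < d ->
    `|u (q + s%:C *: v) - u q - s * dirder u v p| <= e * `|s|.
Proof.
move=> oU Up u1 e0.
have k0 : 0 < 2 + sumnorm v by have := sumnorm_ge0 v; lra.
have /nbhs_sumnormP[d d0 dP] :
    nbhs p (U `&` [set y | `|dirder u v y - dirder u v p| < e]).
  apply: filterI; first exact: open_nbhs_nbhs.
  have [_ /cvgrPdist_lt/(_ e e0)] := u1 v p Up.
  by apply: filterS => y /=; rewrite distrC.
exists (d / (2 + sumnorm v)); first by rewrite divr_gt0.
move=> q s qp sd.
have [x xs|x xs] := @mean_value_from0 _ (fun t : R => u (q + t%:C *: v)) s.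
  apply/(dirder_along u v q x).1.
  have [Ux _] := dP _ (near_line qp (le_lt_trans xs sd)).
  exact: (u1 v _ Ux).1.
have [Ux /= vx] := dP _ (near_line qp (le_lt_trans xs sd)).
rewrite (dirder_along u v q x).2 [0%:C]/(0 : C) scale0r addr0 => ->.
rewrite mulrC -mulrBr normrM mulrC ler_wpM2r//; exact: ltW.
Qed.

(** Second order expansion along v, uniform in the base point q near p; the
    first order coefficient is taken at q, the second order one at p. *)
Lemma C2_step U u p v e : open U -> U p -> C2_on U u -> 0 < e ->
  exists2 d, 0 < d & forall q (s : R), sumnorm (q - p) < d -> `|s| < d ->
    `|u (q + s%:C *: v) - u q - s * dirder u v q
      - s ^+ 2 / 2 * dirder (dirder u v) v p| <= e * s ^+ 2.
Proof.
move=> oU Up [u1 u2] e0.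
have k0 : 0 < 2 + sumnorm v by have := sumnorm_ge0 v; lra.
have [d1 d10 dP1] := C1_step v oU Up (u2 v) e0.
have /nbhs_sumnormP[d d0 dP] : nbhs p U by exact: open_nbhs_nbhs.
exists (Num.min d1 (d / (2 + sumnorm v))); first by rewrite lt_min d10 divr_gt0.
move=> q s; rewrite !lt_min => /andP[qp1 qp] /andP[sd1 sd].
set a := dirder u v q; set b := dirder _ v p.
set f := fun t : R => u (q + t%:C *: v).
pose g := fun t : R => f t - (t * a + t ^+ 2 / 2 * b).
have f1 t : `|t| <= `|s| -> is_derive (t : R^o) (1 : R^o) f (dirder u v (q + t%:C *: v)).
  move=> ts; have := (dirder_along u v q t).2; rewrite derive1E => <-.
  apply: derivableP; apply/(dirder_along u v q t).1.
  have Ux := dP _ (near_line qp (le_lt_trans ts sd)).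
  exact: (u1 v _ Ux).1.
have g1 t : `|t| <= `|s| -> is_derive (t : R^o) (1 : R^o) g
    (dirder u v (q + t%:C *: v) - (a + t * b)).
  move=> /f1 ft; apply: is_deriveB.
  apply: is_derive_eq.
  by rewrite /GRing.scale /=; lra.
have [x xs|x xs] := @mean_value_from0 _ g s.
  by have [] := g1 x xs.
have [_] := g1 x xs; rewrite derive1E => -> E.
have := dP1 q x qp1 (le_lt_trans xs sd1).
have -> : u (q + s%:C *: v) - u q - s * a - s ^+ 2 / 2 * b = g s - g 0.
  by rewrite /g /f [0%:C]/(0 : C) scale0r addr0; lra.
rewrite E normrM opprD addrA => H.
apply: le_trans (ler_wpM2r _ H) _ => //.
by rewrite -mulrA ler_wpM2l ?(ltW e0)// -(real_normK (num_real s)) expr2 ler_wpM2r.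
Qed.

Lemma sumnorm_basis : [/\ sumnorm (1 : C, 0 : C) = 1 :> R,
  sumnorm ('i : C, 0 : C) = 1 :> R, sumnorm (0 : C, 1 : C) = 1 :> R &
  sumnorm (0 : C, 'i : C) = 1 :> R].
Proof.
by split; rewrite /sumnorm /= !(expr0n, expr1n) /= ?(addr0, add0r, sqrtr0, sqrtr1).
Qed.

(** The real differential of a function on C^2, in terms of its four real
    partial derivatives. *)
Definition diffR u p (y : C2) : R :=
  complex.Re y.1 * dirder u (1, 0) p + complex.Im y.1 * dirder u ('i, 0) p +
  complex.Re y.2 * dirder u (0, 1) p + complex.Im y.2 * dirder u (0, 'i) p.

Let ler_norm4 (a b c d a' b' c' d' : R) : `|a| <= a' -> `|b| <= b' ->
  `|c| <= c' -> `|d| <= d' -> `|a + b + c + d| <= a' + b' + c' + d'.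
Proof.
move=> h1 h2 h3 h4.
by do 3![apply: le_trans (ler_normD _ _) _; apply: lerD => //].
Qed.

Let telescope4 (e S x1 x2 x3 x4 a1 a2 a3 a4 u0 u1 u2 u3 u4 : R) :
  0 < e -> `|x1| <= S -> `|x2| <= S -> `|x3| <= S -> `|x4| <= S ->
  `|u1 - u0 - x1 * a1| <= e / 4 * `|x1| ->
  `|u2 - u1 - x2 * a2| <= e / 4 * `|x2| ->
  `|u3 - u2 - x3 * a3| <= e / 4 * `|x3| ->
  `|u4 - u3 - x4 * a4| <= e / 4 * `|x4| ->
  `|u4 - u0 - (x1 * a1 + x2 * a2 + x3 * a3 + x4 * a4)| <= e * S.
Proof.
move=> e0 x1S x2S x3S x4S h1 h2 h3 h4.
have e40 : 0 <= e / 4 by lra.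
have {}h1 := le_trans h1 (ler_wpM2l e40 x1S).
have {}h2 := le_trans h2 (ler_wpM2l e40 x2S).
have {}h3 := le_trans h3 (ler_wpM2l e40 x3S).
have {}h4 := le_trans h4 (ler_wpM2l e40 x4S).
have -> : u4 - u0 - (x1 * a1 + x2 * a2 + x3 * a3 + x4 * a4) =
  (u1 - u0 - x1 * a1) + (u2 - u1 - x2 * a2) +
  (u3 - u2 - x3 * a3) + (u4 - u3 - x4 * a4) by ring.
have -> : e * S = e / 4 * S + e / 4 * S + e / 4 * S + e / 4 * S by field.
exact: ler_norm4.
Qed.

Lemma diffRZ u p (t : R) y : diffR u p (t%:C *: y) = t * diffR u p y.
Proof.
rewrite /diffR; move: (dirder u _ p) (dirder u _ p) (dirder u _ p) (dirder u _ p).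
by case: y => [[? ?] [? ?]] /= a b c d; ring.
Qed.

(** Differentiability at p, by telescoping over the four real directions. *)
Lemma C1_expansion U u p e : open U -> U p -> C1_on U u -> 0 < e ->
  exists2 d, 0 < d & forall y, sumnorm y < d ->
    `|u (p + y) - u p - diffR u p y| <= e * sumnorm y.
Proof.
move=> oU Up u1 e0; have e40 : 0 < e / 4 by rewrite divr_gt0.
have [d1 d10 D1] := C1_step (1, 0) oU Up u1 e40.
have [d2 d20 D2] := C1_step ('i, 0) oU Up u1 e40.
have [d3 d30 D3] := C1_step (0, 1) oU Up u1 e40.
have [d4 d40 D4] := C1_step (0, 'i) oU Up u1 e40.
exists (Num.min (Num.min d1 d2) (Num.min d3 d4) / 4).
  by rewrite divr_gt0// !lt_min d10 d20 d30 d40.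
move=> y; rewrite ltr_pdivlMr// !lt_min => /andP[/andP[y1 y2] /andP[y3 y4]].
have n1 : normc y.1 <= sumnorm y by rewrite lerDl normc_ge0.
have n2 : normc y.2 <= sumnorm y by rewrite lerDr normc_ge0.
have x1S := le_trans (Re_le_normc y.1) n1.
have x2S := le_trans (Im_le_normc y.1) n1.
have x3S := le_trans (Re_le_normc y.2) n2.
have x4S := le_trans (Im_le_normc y.2) n2.
set q1 := p + (complex.Re y.1)%:C *: (1, 0).
set q2 := q1 + (complex.Im y.1)%:C *: ('i, 0).
set q3 := q2 + (complex.Re y.2)%:C *: (0, 1).
have q4E : q3 + (complex.Im y.2)%:C *: (0, 'i) = p + y.
  rewrite /q3 /q2 /q1 -!addrA; congr (_ + _).
  case: y {y1 y2 y3 y4 n1 n2 x1S x2S x3S x4S q1 q2 q3} => [[x1 x2] [x3 x4]] /=.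
  by apply/pair_equal_spec; split; apply/eqP; rewrite eq_complex /=; apply/andP;
    split; apply/eqP; ring.
have [e1 e2 e3 e4] := sumnorm_basis.
have s0 : sumnorm (p - p) <= 0 by rewrite subrr sumnorm0.
have s1 : sumnorm (q1 - p) <= sumnorm y.
  by rewrite /q1 addrC addKr sumnormZ normc_real e1 mulr1.
have s2 : sumnorm (q2 - p) <= sumnorm y + sumnorm y.
  rewrite -(subrKA q1); apply: le_trans (sumnormD _ _) (lerD _ s1).
  by rewrite /q2 (addrC q1) addrK sumnormZ normc_real e2 mulr1.
have s3 : sumnorm (q3 - p) <= sumnorm y + (sumnorm y + sumnorm y).
  rewrite -(subrKA q2); apply: le_trans (sumnormD _ _) (lerD _ s2).
  by rewrite /q3 (addrC q2) addrK sumnormZ normc_real e3 mulr1.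
have small (k a d : R) (k4 : k <= 4) : a <= k * sumnorm y -> sumnorm y * 4 < d -> a < d.
  move=> ak yd.
  apply: (le_lt_trans ak (le_lt_trans _ yd)).
  by rewrite mulrC ler_wpM2l// sumnorm_ge0.
have k0 : 0 <= 4 :> R by exact: ler0n.
have k1 : 1 <= 4 :> R by rewrite ler1n.
have k2 : 2 <= 4 :> R by rewrite ler_nat.
have k3 : 3 <= 4 :> R by rewrite ler_nat.
rewrite -q4E; apply: (telescope4 e0 x1S x2S x3S x4S).
- by apply: D1; [apply: (small _ _ _ k0 _ y1); rewrite mul0r
                |apply: (small _ _ _ k1 _ y1); rewrite mul1r].
- by apply: D2; apply: (small _ _ _ k1 _ y2); rewrite mul1r.
- apply: D3; last by apply: (small _ _ _ k1 _ y3); rewrite mul1r.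
  by apply: (small _ _ _ k2 _ y3); rewrite mulrDl mul1r.
- apply: D4; last by apply: (small _ _ _ k1 _ y4); rewrite mul1r.
  by apply: (small _ _ _ k3 _ y4); rewrite (_ : 3 = 1 + 2 :> R) ?mulrDl ?mul1r//; ring.
Qed.

Lemma C1_continuous U u p e : open U -> U p -> C1_on U u -> 0 < e ->
  exists2 d, 0 < d & forall y, sumnorm (y - p) < d -> `|u y - u p| < e.
Proof.
move=> oU Up u1 e0.
have [d d0 dP] := C1_expansion oU Up u1 ltr01.
(* 1 for the error term of the expansion, the rest bounds the differential *)
pose K := 1 + (`|dirder u (1, 0) p| + `|dirder u ('i, 0) p| +
  `|dirder u (0, 1) p| + `|dirder u (0, 'i) p|).
have K0 : 0 < K by rewrite ltr_wpDr// !addr_ge0.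
exists (Num.min d (e / K)); first by rewrite lt_min d0 divr_gt0.
move=> y; rewrite lt_min => /andP[yd]; rewrite ltr_pdivlMr// => ye.
apply: le_lt_trans ye; have := dP _ yd; rewrite mul1r (addrC p) subrK => h.
rewrite -[X in `|X|](subrK (diffR u p (y - p))).
apply: le_trans (ler_normD _ _) _; rewrite /K mulrDr mulr1; apply: lerD => //.
have n1 : normc (y - p).1 <= sumnorm (y - p) by rewrite lerDl normc_ge0.
have n2 : normc (y - p).2 <= sumnorm (y - p) by rewrite lerDr normc_ge0.
rewrite /diffR !mulrDr.
apply: ler_norm4; rewrite normrM ler_wpM2r//.
- exact: le_trans (Re_le_normc _) n1.
- exact: le_trans (Im_le_normc _) n1.
- exact: le_trans (Re_le_normc _) n2.
- exact: le_trans (Im_le_normc _) n2.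
Qed.

Lemma dirder_diffR U u p v : open U -> U p -> C1_on U u ->
  dirder u v p = diffR u p v.
Proof.
move=> oU Up u1; apply/eqP; rewrite -subr_eq0 -normr_le0.
apply/ler_addgt0Pr => e e0; rewrite add0r.
have n0 := sumnorm_ge0 v.
pose e' := e / (2 + sumnorm v).
have k0 : 0 < 2 + sumnorm v by rewrite ltr_wpDr.
have e'0 : 0 < e' by rewrite divr_gt0.
have [d1 d10 D1] := C1_expansion oU Up u1 e'0.
have [d2 d20 D2] := C1_step v oU Up u1 e'0.
pose t := Num.min d2 (d1 / (2 + sumnorm v)) / 2.
have m0 : 0 < Num.min d2 (d1 / (2 + sumnorm v)) by rewrite lt_min d20 divr_gt0.
have t0 : 0 < t by rewrite divr_gt0.
have : t < Num.min d2 (d1 / (2 + sumnorm v)) by rewrite ltr_pdivrMr// mulr2n mulrDr mulr1 ltrDl.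
rewrite lt_min => /andP[td2]; rewrite ltr_pdivlMr// => td1.
have tn : normc t%:C = t by rewrite normc_real gtr0_norm.
have {}D1 : `|u (p + t%:C *: v) - u p - t * diffR u p v| <= e' * (t * sumnorm v).
  have -> : t * sumnorm v = sumnorm (t%:C *: v) by rewrite sumnormZ tn.
  rewrite -diffRZ; apply: D1; rewrite sumnormZ tn.
  by apply: le_lt_trans td1; rewrite ler_pM2l// lerDr.
have {}D2 : `|u (p + t%:C *: v) - u p - t * dirder u v p| <= e' * t.
  rewrite -[X in e' * X](gtr0_norm t0); apply: D2; first by rewrite subrr sumnorm0.
  by rewrite gtr0_norm.
rewrite -(ler_pM2l t0) -{1}(gtr0_norm t0) -normrM.
have -> : t * (dirder u v p - diffR u p v) =
  (u (p + t%:C *: v) - u p - t * diffR u p v) -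
  (u (p + t%:C *: v) - u p - t * dirder u v p).
  by rewrite mulrBr opprB [RHS]addrC subrKA.
apply: le_trans (ler_normB _ _) _; apply: le_trans (lerD D1 D2) _.
have -> : e' * (t * sumnorm v) + e' * t = t * (e' * (1 + sumnorm v)) by ring.
rewrite ler_pM2l// /e' -mulrA; apply: ler_piMr; first exact: ltW.
rewrite mulrC ler_pdivrMr// mul1r.
by rewrite lerD2r ler1n.
Qed.

(** The holomorphic differential of u at p is a complex linear form on C^2, so
    it has a nontrivial kernel. *)
Lemma critical_direction U u p : open U -> U p -> C1_on U u ->
  exists b, [/\ b != 0, dirder u b p = 0 & dirder u ('i *: b) p = 0].
Proof.
move=> oU Up u1.
(* a1 and a2 are the coefficients of the form: du(v) = Re (v.1 a1 + v.2 a2) *)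
pose a1 := dirder u (1, 0) p +i* - dirder u ('i, 0) p.
pose a2 := dirder u (0, 1) p +i* - dirder u (0, 'i) p.
have dE v : dirder u v p = complex.Re (v.1 * a1 + v.2 * a2).
  rewrite (dirder_diffR _ oU Up u1) /diffR /a1 /a2.
  move: (dirder u _ p) (dirder u _ p) (dirder u _ p) (dirder u _ p).
  by case: v => [[? ?] [? ?]] /= a b c d; ring.
clearbody a1 a2.
have [/andP[/eqP z1 /eqP z2]|nz] := boolP ((a1 == 0) && (a2 == 0)).
  exists (1, 0); rewrite !dE z1 z2 !mulr0 addr0; split=> //.
  by apply/eqP => -[/eqP]; rewrite oner_eq0.
exists (a2, - a1); rewrite !dE /=; split.
- apply: contra nz => /eqP E; have z2 : a2 = 0 := congr1 fst E.
  have /eqP : - a1 = 0 := congr1 snd E.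
  by rewrite oppr_eq0 z2 eqxx => ->.
- by rewrite (_ : a2 * a1 + _ = 0) //; ring.
- by rewrite (_ : _ + _ = 0) //; rewrite /GRing.scale /=; ring.
Qed.

Let saddle_bound (e x y u0 u1 u2 a a' k D : R) : 0 < e -> a + a' = 0 ->
  `|u2 - u1 - x * D - x ^+ 2 / 2 * a| <= e / 2 * x ^+ 2 ->
  `|u1 - u0 - y * 0 - y ^+ 2 / 2 * a'| <= e / 2 * y ^+ 2 ->
  `|D - 0 - y * k| <= e / 2 * `|y| ->
  `|u2 - u0 - (a / 2 * (x ^+ 2 - y ^+ 2) + k * (x * y))| <= e * (x ^+ 2 + y ^+ 2).
Proof.
move=> e0 aa h1 h2 h3.
have -> : u2 - u0 - (a / 2 * (x ^+ 2 - y ^+ 2) + k * (x * y)) =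
  (u2 - u1 - x * D - x ^+ 2 / 2 * a) + (u1 - u0 - y * 0 - y ^+ 2 / 2 * a')
   + x * (D - 0 - y * k).
  have -> : a' = - a by lra.
  by field.
have {}h3 : `|x * (D - 0 - y * k)| <= e / 4 * (x ^+ 2 + y ^+ 2).
  rewrite normrM; apply: le_trans (ler_wpM2l _ h3) _ => //.
  rewrite -(real_normK (num_real x)) -(real_normK (num_real y)).
  have := sqr_ge0 (`|x| - `|y|); nra.
apply: le_trans (ler_normD _ _) _; apply: le_trans (lerD (ler_normD _ _) h3) _.
apply: le_trans (lerD (lerD h1 h2) (lexx _)) _.
have := sqr_ge0 x; have := sqr_ge0 y; nra.
Qed.

(** Along a complex line on which the first derivatives vanish and the Laplacian
    is zero, the second order part is a combination of x^2 - y^2 and x y, the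
    real and imaginary parts of (x + i y)^2 up to a factor. *)
Lemma C2_critical_line U u p b e : open U -> U p -> C2_on U u -> 0 < e ->
  dirder u b p = 0 -> dirder u ('i *: b) p = 0 ->
  dirder (dirder u b) b p + dirder (dirder u ('i *: b)) ('i *: b) p = 0 ->
  exists2 d, 0 < d & forall x y : R, `|x| < d -> `|y| < d ->
    `|u (p + (x +i* y) *: b) - u p
       - (dirder (dirder u b) b p / 2 * (x ^+ 2 - y ^+ 2)
          + dirder (dirder u b) ('i *: b) p * (x * y))|
    <= e * (x ^+ 2 + y ^+ 2).
Proof.
move=> oU Up u2 e0 b0 ib0 lap; have e20 : 0 < e / 2 by rewrite divr_gt0.
have [d1 d10 D1] := C2_step b oU Up u2 e20.
have [d2 d20 D2] := C2_step ('i *: b) oU Up u2 e20.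
have [d3 d30 D3] := C1_step ('i *: b) oU Up (u2.2 b) e20.
have n0 : 0 < 1 + sumnorm b by rewrite ltr_wpDr// sumnorm_ge0.
have nn0 := sumnorm_ge0 b.
exists (Num.min (Num.min d1 (d1 / (1 + sumnorm b))) (Num.min d2 d3)).
  by rewrite !lt_min d10 d20 d30 divr_gt0.
move=> x y; rewrite !lt_min => /andP[/andP[x1 _] _].
move=> /andP[/andP[_ y1] /andP[y2 y3]].
have pp0 d : 0 < d -> sumnorm (p - p) < d by rewrite subrr sumnorm0.
have i1 : normc ('i : C) = 1 by rewrite /= expr0n expr1n add0r sqrtr1.
have qE : p + (x +i* y) *: b = p + y%:C *: ('i *: b) + x%:C *: b.
  rewrite -addrA; congr (_ + _); rewrite scalerA -scalerDl; congr (_ *: _).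
  by apply/eqP; rewrite eq_complex /=; apply/andP; split; apply/eqP; ring.
have h2 := D2 p y (pp0 _ d20) y2.
have h3 := D3 p y (pp0 _ d30) y3.
have h1 := D1 (p + y%:C *: ('i *: b)) x.
rewrite qE; apply: saddle_bound e0 lap (h1 _ x1) _ _.
- rewrite addrC addKr !sumnormZ normc_real i1 mul1r.
  move: y1; rewrite ltr_pdivlMr//; apply: le_lt_trans.
  by rewrite ler_wpM2l// lerDr.
- by rewrite -[X in y * X]ib0.
- by rewrite -[X in _ - X - _]b0.
Qed.


End DirectionalCalculus.

(** * The submean inequality on circles *)

Section CircleMeans.
Context {R : realType}.
Local Notation C := R[i].
Local Notation C2 := (C * C)%type.

Lemma continuous_trig (A al be ga ka : R) :
  continuous (fun t : R => A + al * cos t + be * sin t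
    + ga * (cos t ^+ 2 - sin t ^+ 2) + ka * (cos t * sin t)).
Proof.
move=> t.
have cc : {for t, continuous (@cos R)} by exact: continuous_cos.
have cs : {for t, continuous (@sin R)} by exact: continuous_sin.
apply: cvgD; first apply: cvgD; first apply: cvgD; first apply: cvgD.
- exact: cvg_cst.
- by apply: cvgMr; exact: cc.
- by apply: cvgMr; exact: cs.
- by apply: cvgMr; apply: cvgB; apply: cvgM.
- by apply: cvgMr; apply: cvgM.
Qed.

Lemma integral_trig (A al be ga ka : R) :
  (\int[@lebesgue_measure R]_(t in `[0%R, (2 * pi)%R])
   (A + al * cos t + be * sin t + ga * (cos t ^+ 2 - sin t ^+ 2)
      + ka * (cos t * sin t))%:E = (2 * pi * A)%:E)%E.
Proof.
pose F (t : R) : R := A * t + al * sin t - be * cos t + ga * (sin t * cos t)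
   + ka / 2 * (sin t * sin t).
have dF (t : R) : is_derive (t : R^o) (1 : R^o) F (A + al * cos t + be * sin t
   + ga * (cos t ^+ 2 - sin t ^+ 2) + ka * (cos t * sin t)).
  by apply: is_derive_eq; rewrite /GRing.scale /=; field.
have pi0 := pi_gt0 R.
have cF : continuous (F : R -> R).
  by move=> t; apply/differentiable_continuous/derivable1_diffP; have [] := dF t.
rewrite (@continuous_FTC2 _ _ F).
- rewrite /F -EFinB; congr (_%:E).
  have -> : 2 * pi = pi + pi :> R by ring.
  by rewrite sinD cosD sinpi cospi sin0 cos0; ring.
- by rewrite mulr_gt0.
- exact/continuous_subspaceT/continuous_trig.
- split.
  + by move=> t _; have [] := dF t.
  + by apply: cvg_at_right_filter; exact: cF.
  + by apply: cvg_at_left_filter; exact: cF.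
- by move=> t _; rewrite derive1E; have [_ ->] := dF t.
Qed.

(** The submean inequality, in the form in which it is used: a bound on a circle
    by a constant A plus terms of mean zero passes to the centre as A. *)
Lemma circle_mean_le (V : normedModType C) (U : set V) (u : V -> R) (a b : V)
    (r A al be ga ka : R) :
  {within U, continuous u} -> plurisubharmonic U (EFin \o u) -> 0 < r ->
  (forall l, normc l <= r -> U (a + l *: b)) ->
  (forall t : R, u (a + ((r * cos t) +i* (r * sin t)) *: b) <=
     A + al * cos t + be * sin t + ga * (cos t ^+ 2 - sin t ^+ 2)
      + ka * (cos t * sin t)) ->
  u a <= A.
Proof.
move=> cu [_ _ pu] r0 rU uA.
have [_ _ /(_ 0 r r0)] := pu a b.
have rd : cdisc (0 : C) r `<=` [set l | U (a + l *: b)].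
  by move=> l; rewrite /cdisc /= subr0; exact: rU.
move=> /(_ rd) /=; rewrite scale0r addr0 => mean.
have cE t : circle_pt 0 r t = (r * cos t) +i* (r * sin t).
  by rewrite /circle_pt add0r; apply/eqP; rewrite eq_complex /=; apply/andP;
    split; apply/eqP; ring.
have pi0 := pi_gt0 R.
rewrite -lee_fin; apply: le_trans mean _.
rewrite -[leRHS](_ : ((2 * pi)^-1)%:E * (2 * pi * A)%:E = _)%E; last first.
  by rewrite -EFinM mulrA mulVf ?mul1r// mulf_neq0 ?gt_eqF.
rewrite lee_pmul2l//; last by rewrite lte_fin invr_gt0 mulr_gt0.
rewrite -(integral_trig A al be ga ka).
have cseg : compact (`[0, 2 * pi]%classic : set R) by exact: segment_compact.
apply: le_integral => //.
- apply: (@continuous_compact_integrable R (fun t : R => u (a + circle_pt 0 r t *: b))) => //.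
  apply: continuous_subspaceT => t.
  have Ut : U (a + circle_pt 0 r t *: b).
    by apply: rU; rewrite /circle_pt add0r normcM normc_real gtr0_norm//= cos2Dsin2 sqrtr1 mulr1.
  have gc : continuous (fun t : R => a + circle_pt 0 r t *: b).
    move=> {Ut}t.
    have cc : continuous (circle_pt (0 : C) r).
      have -> : circle_pt (0 : C) r = fun s => (r * cos s) +i* (r * sin s).
        by apply/funext => s; exact: cE.
      apply: (@continuous_complex R R (fun s => r * cos s) (fun s => r * sin s)).
        by move=> s; apply: cvgMr; exact: continuous_cos.
      by move=> s; apply: cvgMr; exact: continuous_sin.
    by apply: cvgD; [exact: cvg_cst|apply: cvgZl; exact: cc].
  move=> P /= uP.
  have /subspace_continuousP/(_ _ Ut _ uP) := cu; rewrite /nbhs /= /within /= => h.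
  have hs : \forall s \near t, U (a + circle_pt 0 r s *: b) ->
      P (u (a + circle_pt 0 r s *: b)) by exact: gc t _ h.
  suff : \forall s \near t, P (u (a + circle_pt 0 r s *: b)) by [].
  apply: filterS hs => s; apply.
  by apply: rU; rewrite /circle_pt add0r normcM normc_real gtr0_norm//= cos2Dsin2 sqrtr1 mulr1.
- apply: (@continuous_compact_integrable R (fun t : R => A + al * cos t + be * sin t
   + ga * (cos t ^+ 2 - sin t ^+ 2) + ka * (cos t * sin t))) => //.
  exact/continuous_subspaceT/continuous_trig.
- by move=> t _; rewrite lee_fin cE.
Qed.

End CircleMeans.

(** * Hausdorff limits and the Wermer type set *)

Section WermerSet.
Context {R : realType}.
Local Notation C := R[i].
Local Notation C2 := (C * C)%type.
Implicit Types (A U : set C2) (x y p q b : C2).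

Lemma normc_le_cnorm2 p : normc p.1 <= cnorm2 p /\ normc p.2 <= cnorm2 p.
Proof.
have h (t : R) : 0 <= t -> t = Num.sqrt (t ^+ 2) by move=> t0; rewrite sqrtr_sqr ger0_norm.
by split; rewrite [leLHS]h ?normc_ge0//; apply: ler_wsqrtr;
  rewrite ?lerDl ?lerDr sqr_ge0.
Qed.

Lemma cnorm2_le_sumnorm p : cnorm2 p <= sumnorm p.
Proof.
rewrite -[leRHS]ger0_norm ?sumnorm_ge0// -sqrtr_sqr; apply: ler_wsqrtr.
rewrite /sumnorm; have := normc_ge0 p.1; have := normc_ge0 p.2; nra.
Qed.

Lemma hausdorff_limitP (A : nat -> set C2) (L : set C2) (d : R) :
  hausdorff_limit A L -> 0 < d ->
  \forall n \near \oo, (forall x, A n x -> exists2 y, L y & sumnorm (x - y) < d) /\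
    (forall x, L x -> exists2 y, A n y & sumnorm (x - y) < d).
Proof.
move=> [_ AL] d0.
have d20 : 0 < d / 2 by rewrite divr_gt0.
have : \forall n \near \oo, (hausdorff_dist (A n) L < (d / 2)%:E)%E.
  have e0 : (0%:E < (d / 2)%:E)%E by rewrite lte_fin.
  exact: (AL [set x | (x < (d / 2)%:E)%E] (open_ereal_lt' e0)).
have fat (B : set C2) x t : t < d / 2 -> fattening B t x ->
    exists2 y, B y & sumnorm (x - y) < d.
  move=> td [y By xy]; exists y => //.
  have [h1 h2] := normc_le_cnorm2 (x - y).
  rewrite /sumnorm; lra.
apply: filterS => n /ereal_inf_lt[_ [t [t0 AB BA] <-]]; rewrite lte_fin => td.
by split=> x; [move=> /AB|move=> /BA]; exact: fat.
Qed.

(** If p is a limit of points q of the Wermer type set, then p belongs to the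
    Hausdorff limit L of the traces of the E_n on a fixed ball around p: the
    points q, which may come from limits on other balls, are close to points of
    E_n lying in that ball. *)
Lemma wermer_set_closed (eps : nat -> R) p : wermer_limits_exist eps ->
  (forall d, 0 < d -> exists2 q, wermer_set eps q & sumnorm (q - p) < d) ->
  wermer_set eps p.
Proof.
move=> lim cl.
have r0 : 0 < sumnorm p + 2 by rewrite ltr_wpDl// sumnorm_ge0.
have [L limL] := lim _ r0.
exists (sumnorm p + 2), L; split => //.
have cL : closed L.
  by apply: compact_closed; [exact: norm_hausdorff|case: limL].
apply: cL => P /nbhs_sumnormP[d d0 dP].
pose t := Num.min (d / 3) 1.
have t0 : 0 < t by rewrite lt_min ltr01 divr_gt0.
have td : t <= d / 3 by rewrite ge_min lexx.
have t1 : t <= 1 by rewrite ge_min lexx orbT.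
have [q [s [L' [s0 limL' L'q]]] qp] := cl t t0.
have [n [[_ hL'] [hL _]]] : exists n,
    ((forall x, (E_ eps n `&` cball2 s) x -> exists2 y, L' y & sumnorm (x - y) < t) /\
    (forall x, L' x -> exists2 y, (E_ eps n `&` cball2 s) y & sumnorm (x - y) < t)) /\
    ((forall x, (E_ eps n `&` cball2 (sumnorm p + 2)) x -> exists2 y, L y & sumnorm (x - y) < t) /\
    (forall x, L x -> exists2 y, (E_ eps n `&` cball2 (sumnorm p + 2)) y & sumnorm (x - y) < t)).
  have h1 := hausdorff_limitP limL' t0; have h2 := hausdorff_limitP limL t0.
  by have [n] := filter_ex (filterI h1 h2); exists n.
have [y [Ey _] qy] := hL' q L'q.
have py : sumnorm (y - p) < t + t.
  rewrite -(subrKA q); apply: le_lt_trans (sumnormD _ _) _.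
  by rewrite ltrD// sumnormB.
have [|z Lz yz] := hL y.
  split => //; rewrite /cball2 /=; apply: le_trans (cnorm2_le_sumnorm _) _.
  rewrite -(subrK p y); apply: le_trans (sumnormD _ _) _.
  by clear -py t1; lra.
exists z; split => //; apply: dP.
rewrite -(subrKA y); apply: le_lt_trans (sumnormD _ _) _.
rewrite sumnormB; clear -py yz td; lra.
Qed.

(** The first hypothesis says that A is closed.  Without such a p, A would be
    clopen, and so would its trace on a real line joining a point of A to one
    outside. *)
Lemma exists_boundary_point A :
  (forall p, ~ A p -> exists2 d : R, 0 < d & forall q, sumnorm (q - p) < d -> ~ A q) ->
  A !=set0 -> ~ (forall p, A p) ->
  exists2 p, A p & forall d : R, 0 < d -> exists2 q, ~ A q & sumnorm (q - p) < d.
Proof.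
move=> clA [p Ap] /existsNP[q nAq].
apply: contrapT => noBd.
have opA x : A x -> exists2 d : R, 0 < d & forall y, sumnorm (y - x) < d -> A y.
  move=> Ax; apply: contrapT => nd; apply: noBd; exists x => // d d0.
  apply: contrapT => nq; apply: nd; exists d => // y yx.
  by apply: contrapT => nAy; apply: nq; exists y.
pose g (t : R) := p + t%:C *: (q - p).
pose B := [set t : R | A (g t)].
have n0 : 0 < 1 + sumnorm (q - p) by rewrite ltr_wpDr// sumnorm_ge0.
have gP (P : set C2) (t : R) :
    (exists2 d : R, 0 < d & forall y, sumnorm (y - g t) < d -> P y) ->
    nbhs t [set s | P (g s)].
  move=> [d d0 dP]; apply/nbhs_realP; exists (d / (1 + sumnorm (q - p))).
    by rewrite divr_gt0.
  move=> s; rewrite ltr_pdivlMr// => st; apply: dP.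
  rewrite /g opprD addrACA subrr add0r -scalerBl -rmorphB sumnormZ normc_real.
  by apply: le_lt_trans st; rewrite ler_wpM2l// lerDr.
have oB : open B by rewrite openE => t /opA; exact: gP.
have cB : closed B.
  by rewrite -openC openE => t /clA; exact: gP.
have : B = setT.
  have /connected_intervalP : is_interval [set: R] by [].
  apply.
  - by exists 0; rewrite /B /g /= [0%:C]/(0 : C) scale0r addr0.
  - by exists B => //; rewrite setTI.
  - by exists B => //; rewrite setTI.
move=> /(congr1 (fun S => S 1)); rewrite /B /g /=.
by rewrite [1%:C]/(1 : C) scale1r addrC subrK => AT; apply: nAq; rewrite AT.
Qed.

Lemma convex_weight_bounded (c : nat -> R) (rho : R -> R) (M : R) :
  convex_weight c rho -> 0 <= M ->
  exists B : R, forall t : R, 0 <= t <= M -> rho t <= B.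
Proof.
move=> [_ _ [h [rhoE dh _]] _] M0.
have ch : {within `[0, M], continuous h}.
  by apply: derivable_within_continuous => x _; exact: (dh 0).
have [t tM tmax] := EVT_max M0 ch.
exists (h t) => x /andP[x0 xM]; rewrite rhoE//; apply: tmax.
by rewrite in_itv/= x0.
Qed.

(** One graph suffices: the parameter space is pointed and S_1 contains 3/2. *)
Lemma graph_family_nonempty (E : set C2) (A : pseudoPMetricType R)
    (F : C -> A -> C -> C) : graph_family E F -> E !=set0.
Proof.
pose z : C := (3 / 2)%:C.
have Sz : S_ 1 z.
  split; first by split => /=; apply/andP; split; lra.
  by move=> [/andP[_ /= h] _]; lra.
move=> /(_ 1%N z isT Sz)[_ EF].
have [Ez _] : (E `&` Defs.over (disc z (1 / 4))) (z, F z point z).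
  rewrite EF; exists point => //; split => //.
  by rewrite /disc /mkset subrr normc0 divr_gt0.
by exists (z, F z point z).
Qed.


End WermerSet.

(** * The penalized maximum principle *)

Section Penalization.
Context {R : realType}.
Local Notation C := R[i].
Local Notation C2 := (C * C)%type.
Implicit Types (A U : set C2) (x y p q b : C2).

Lemma expR_le_quadratic (s : R) : s <= 1 / 2 -> expR s <= 1 + s + 2 * s ^+ 2.
Proof.
move=> s2; have := expR_ge1Dx (- s); rewrite expRN => h.
have e0 := expR_gt0 s.
have {}h : expR s * (1 - s) <= 1.
  by rewrite mulrC -ler_pdivlMr// mul1r.
have s1 : 0 < 1 - s by lra.
rewrite -(ler_pM2r s1); apply: le_trans h _.
have := sqr_ge0 s; nra.
Qed.

Lemma sqnorm_line p b : exists al be : R, forall x y : R,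
  sqnorm (p + (x +i* y) *: b) =
  sqnorm p + x * al + y * be + (x ^+ 2 + y ^+ 2) * sqnorm b.
Proof.
case: p b => [[a1 a2] [a3 a4]] [[b1 b2] [b3 b4]].
exists (2 * (a1 * b1 + a2 * b2 + a3 * b3 + a4 * b4)).
exists (2 * (a2 * b1 - a1 * b2 + a4 * b3 - a3 * b4)).
by move=> x' y'; rewrite /sqnorm /=; ring.
Qed.

Lemma sqnorm_gt0 b : b != 0 -> 0 < sqnorm b.
Proof.
move=> b0; rewrite lt_def; apply/andP; split; last by rewrite !addr_ge0 ?sqr_ge0.
apply: contra b0; case: b => [[b1 b2] [b3 b4]]; rewrite /sqnorm /=.
rewrite !paddr_eq0 ?addr_ge0 ?sqr_ge0// !sqrf_eq0.
by move=> /andP[/andP[/eqP-> /eqP->] /andP[/eqP-> /eqP->]].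
Qed.

(** The values at a point of the circle (v, Q, h, E) and at its centre (v0, Q0,
    h0, E0) of the function, of the square norm, of the pluriharmonic function h
    and of its exponential; S is the second order part of h, r2 the square of
    the radius. *)
Let pointwise (v v0 Q Q0 h h0 de eta la E E0 S e K r2 : R) :
  0 <= la -> 0 <= E0 -> 0 <= K ->
  v + de * Q + eta * h - la * E <= v0 + de * Q0 + eta * h0 - la * E0 ->
  E <= E0 * (1 + (h - h0) + 2 * (h - h0) ^+ 2) ->
  `|h - h0 - S| <= e * r2 -> `|h - h0| <= K * r2 ->
  v <= v0 - de * (Q - Q0) - (eta - la * E0) * S
     + (`|eta - la * E0| * e * r2 + 2 * (la * E0) * K ^+ 2 * r2 ^+ 2).
Proof.
move=> la0 E00 K0 H HE HS Hh.
have L0 : 0 <= la * E0 by rewrite mulr_ge0.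
have {HE} HE := ler_wpM2l la0 HE.
have sq : (h - h0) ^+ 2 <= K ^+ 2 * r2 ^+ 2.
  by rewrite -exprMn -(real_normK (num_real (h - h0))) lerXn2r ?nnegrE// (le_trans _ Hh).
have {sq} sq := ler_wpM2l L0 sq.
have lin : - ((eta - la * E0) * (h - h0 - S)) <= `|eta - la * E0| * e * r2.
  apply: le_trans (ler_norm _) _; rewrite normrN normrM -mulrA.
  by apply: ler_wpM2l.
lra.
Qed.

Let saddle_norm (a k c s r : R) : c ^+ 2 + s ^+ 2 = 1 ->
  `|r ^+ 2 * (a / 2 * (c ^+ 2 - s ^+ 2) + k * (c * s))| <= (`|a| + `|k|) * r ^+ 2.
Proof.
move=> cs; have [c2 s2] : c ^+ 2 <= 1 /\ s ^+ 2 <= 1.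
  by rewrite -cs lerDl lerDr !sqr_ge0.
rewrite normrM (ger0_norm (sqr_ge0 r)) mulrC ler_wpM2r ?sqr_ge0//.
apply: le_trans (ler_normD _ _) _; rewrite !normrM; apply: lerD.
  rewrite [`|2^-1|]ger0_norm ?invr_ge0// -mulrA ler_piMr//.
  rewrite mulrC ler_pdivrMr// mul1r ler_norml.
  by have := sqr_ge0 c; have := sqr_ge0 s; move=> ? ?; apply/andP; split; lra.
rewrite ler_piMr//.
have n1 (t : R) : t ^+ 2 <= 1 -> `|t| <= 1 by move=> t1; rewrite -sqrtr_sqr -[leRHS]sqrtr1 ler_wsqrtr.
by rewrite -(mulr1 1) ler_pM// n1.
Qed.

Let deviation (D S M e r2 : R) : `|D - S| <= e * r2 -> `|S| <= M * r2 ->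
  e <= 1 -> 0 <= r2 -> `|D| <= (M + 1) * r2.
Proof.
move=> h1 h2 e1 r20; rewrite -[D](subrK S); apply: le_trans (ler_normD _ _) _.
have := ler_wpM2r r20 e1; lra.
Qed.

Let half_bound (r K : R) : 0 < r -> r <= 1 -> 0 <= K -> r * (2 * K) <= 1 ->
  K * r ^+ 2 <= 1 / 2.
Proof.
move=> r0 r1 K0 rK; have h : 0 <= r * (2 * K) by rewrite !mulr_ge0// ltW.
have := ler_wpM2r h r1; rewrite mul1r expr2; lra.
Qed.

(** The local step of the maximum principle.  The set G is the domain of v;
    the hypothesis quantified over b, r and A is the submean inequality of v on
    circles centred at p, in the form of [circle_mean_le].
    At a local maximum p of v + de sqnorm + eta h - la e^h, on the line through p
    in a critical direction b of h, v is bounded on the circle of radius r by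
      v p - de (sqnorm b) r^2 + (terms of mean 0) + o(r^2). *)
Lemma penalized_no_local_max U G (v h : C2 -> R) p (de eta la d0 : R) :
  open U -> U p -> C2_on U h ->
  (forall b, dirder (dirder h b) b p + dirder (dirder h ('i *: b)) ('i *: b) p = 0) ->
  (forall b (r A al be ga ka : R), 0 < r ->
    (forall l, normc l <= r -> G (p + l *: b)) ->
    (forall t : R, v (p + ((r * cos t) +i* (r * sin t)) *: b) <=
     A + al * cos t + be * sin t + ga * (cos t ^+ 2 - sin t ^+ 2)
      + ka * (cos t * sin t)) -> v p <= A) ->
  0 < de -> 0 <= la -> 0 < d0 ->
  ~ (forall q, sumnorm (q - p) < d0 -> G q /\
      v q + de * sqnorm q + eta * h q - la * expR (h q) <=
      v p + de * sqnorm p + eta * h p - la * expR (h p)).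
Proof.
move=> oU Up h2 lap mean de0 la0 d00 maxp.
have [b [b0 cb cib]] := critical_direction oU Up h2.1.
have n0 := sqnorm_gt0 b0.
set n := sqnorm b in n0 *.
set L := la * expR (h p); have L0 : 0 <= L by rewrite mulr_ge0// expR_ge0.
(* relative precision of the expansion of h: the errors it causes stay below a
   quarter of the gain de n r^2 *)
pose e := Num.min 1 (de * n / (4 * (`|eta - L| + 1))).
have k10 : 0 < 4 * (`|eta - L| + 1) by rewrite mulr_gt0// ltr_wpDl.
have e0 : 0 < e by rewrite lt_min ltr01 divr_gt0// mulr_gt0.
have e1 : e <= 1 by rewrite ge_min lexx.
have eT : `|eta - L| * e <= de * n / 4.
  have : e <= de * n / (4 * (`|eta - L| + 1)) by rewrite ge_min lexx orbT.
  rewrite ler_pdivlMr//; have := normr_ge0 (eta - L); nra.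
have [d1 d10 line] := C2_critical_line oU Up h2 e0 cb cib (lap b).
move: line; set a := dirder (dirder h b) b p; set k := dirder (dirder h b) _ p => line.
have [al [be sqE]] := sqnorm_line p b.
pose K := `|a| + `|k| + 1.
have K1 : 1 <= K by rewrite /K lerDr addr_ge0.
have K0 : 0 <= K by lra.
have nb0 : 0 < 1 + sumnorm b by rewrite ltr_wpDr// sumnorm_ge0.
pose k2 := 8 * (L * K ^+ 2) + 1.
have k20 : 0 < k2 by rewrite /k2 ltr_wpDl// !mulr_ge0// sqr_ge0.
(* rK keeps h - h p below 1/2, rL keeps the quadratic error of e^h below a
   quarter of the gain *)
have [r [r0 r1 rK rL [rd1 rd0]]] : exists r, [/\ 0 < r, r <= 1, r * (2 * K) <= 1,
    r * k2 <= de * n & r < d1 /\ r * (1 + sumnorm b) < d0].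
  pose s := Num.min (Num.min 1 (1 / (2 * K))) (Num.min (de * n / k2)
    (Num.min d1 (d0 / (1 + sumnorm b)))).
  have K20 : 0 < 2 * K by lra.
  have s0 : 0 < s by rewrite !lt_min ltr01 d10 !divr_gt0// mulr_gt0.
  have : s / 2 < s by rewrite ltr_pdivrMr// mulr2n mulrDr mulr1 ltrDl.
  rewrite {2}/s !lt_min => /andP[/andP[s1 s2] /andP[s3 /andP[s4 s5]]].
  exists (s / 2); split; [by rewrite divr_gt0|exact: ltW| | |split => //].
  - by move: s2; rewrite ltr_pdivlMr// => /ltW.
  - by move: s3; rewrite ltr_pdivlMr// => /ltW.
  - by move: s5; rewrite ltr_pdivlMr.
have near l : normc l <= r -> sumnorm (p + l *: b - p) < d0.
  move=> lr; rewrite addrC addKr sumnormZ; apply: le_lt_trans rd0.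
  by apply: ler_pM; rewrite ?normc_ge0 ?sumnorm_ge0 ?lerDr.
pose A := v p - de * n * r ^+ 2 + (`|eta - L| * e * r ^+ 2 + 2 * L * K ^+ 2 * (r ^+ 2) ^+ 2).
have : v p <= A.
  apply: (mean b r A (- de * r * al) (- de * r * be) (- (eta - L) * (a / 2) * r ^+ 2)
    (- (eta - L) * k * r ^+ 2) r0) => [l lr|t].
    exact: (maxp _ (near _ lr)).1.
  set c := cos t; set s := sin t.
  have cs : c ^+ 2 + s ^+ 2 = 1 := cos2Dsin2 t.
  have lr : normc ((r * c) +i* (r * s)) <= r.
    by rewrite /= !exprMn -mulrDr cs mulr1 sqrtr_sqr gtr0_norm.
  have [_] := maxp _ (near _ lr).
  set q := p + _.
  have xyE : (r * c) ^+ 2 + (r * s) ^+ 2 = r ^+ 2 by rewrite !exprMn -mulrDr cs mulr1.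
  have c1 : `|r * c| < d1.
    by apply: le_lt_trans rd1; apply: le_trans lr; exact: (Re_le_normc ((r * c) +i* (r * s))).
  have s1 : `|r * s| < d1.
    by apply: le_lt_trans rd1; apply: le_trans lr; exact: (Im_le_normc ((r * c) +i* (r * s))).
  have := line _ _ c1 s1; rewrite -/q xyE.
  set S := (X in _ - X) => hS.
  have SE : S = r ^+ 2 * (a / 2 * (c ^+ 2 - s ^+ 2) + k * (c * s)) by rewrite /S; ring.
  have SK : `|S| <= (`|a| + `|k|) * r ^+ 2 by rewrite SE; exact: saddle_norm.
  have hK : `|h q - h p| <= K * r ^+ 2 := deviation hS SK e1 (sqr_ge0 r).
  have hE : expR (h q) <= expR (h p) * (1 + (h q - h p) + 2 * (h q - h p) ^+ 2).
    rewrite -[X in expR X](subrK (h p)) expRD mulrC ler_wpM2l ?expR_ge0//.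
    apply: expR_le_quadratic; apply: le_trans (ler_norm _) (le_trans hK _).
    exact: half_bound.
  move=> hv; apply: le_trans (pointwise la0 (expR_ge0 _) K0 hv hE hS hK) _.
  rewrite -/L SE /q sqE -/n xyE /A.
  move: (v p) (`|eta - L|) (sqnorm p) => v0 w sq.
  by rewrite le_eqVlt; apply/orP; left; apply/eqP; field.
rewrite leNgt => /negP; apply.
rewrite /A.
have r20 : 0 < r ^+ 2 by rewrite exprn_gt0.
have i1 : `|eta - L| * e * r ^+ 2 <= de * n / 4 * r ^+ 2 by rewrite ler_wpM2r// ltW.
have i2 : 2 * L * K ^+ 2 * (r ^+ 2) ^+ 2 <= de * n / 4 * r ^+ 2.
  rewrite [(r ^+ 2) ^+ 2]expr2 mulrA ler_wpM2r ?(ltW r20)//.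
  have : r ^+ 2 * k2 <= de * n.
    by apply: le_trans rL; rewrite ler_wpM2r ?(ltW k20)// expr2 ler_piMl// ltW.
  by rewrite /k2 -[2 * L * _]mulrA; move: r20; clear; lra.
have i3 : 0 < de * n * r ^+ 2 by rewrite !mulr_gt0.
lra.
Qed.

End Penalization.

(** * Strong antipeak functions on the tube domain *)

Section Antipeak.
Context {R : realType}.
Local Notation C := R[i].
Local Notation C2 := (C * C)%type.
Implicit Types (A U : set C2) (x y p q b : C2).

(** The point of C^3 with coordinates x in C^2 and zeta in C. *)
Definition pt3 x (zeta : C) : 'rV[C]_3 := \row_j [:: x.1; x.2; zeta]`_j.

Lemma pt3_line p b (l : C) : pt3 (p + l *: b) 1 = pt3 p 1 + l *: pt3 b 0.
Proof.
apply/rowP => -[[|[|[|//]]] ?]; rewrite !mxE //=.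
by rewrite mulr0 addr0.
Qed.

Lemma Omega_Psi_pt3 phi rho x :
  Omega_Psi phi rho (pt3 x 1) <-> (Psi phi rho x < 1%:E)%E.
Proof.
have xE : x = (pt3 x 1 0 0, pt3 x 1 0 1) by rewrite !mxE /=; case: x.
by rewrite /Omega_Psi /= -xE mxE.
Qed.

Lemma sqnorm_le_cnorm x (M : R) : M ^+ 2 < sqnorm x -> M < cnorm (pt3 x 1).
Proof.
move=> Mx; apply: le_lt_trans (ler_norm M) _.
rewrite -sqrtr_sqr /cnorm ltr_sqrt; last first.
  by rewrite !big_ord_recl big_ord0 addr0 !mxE /= ltr_wpDl ?sqr_ge0// ltr_wpDl ?sqr_ge0//
    expr0n addr0 expr1n sqrtr1 expr1n.
apply: lt_le_trans Mx _; rewrite !big_ord_recl big_ord0 addr0 !mxE /=.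
rewrite /sqnorm addrA; case: (x) => [[a1 a2] [a3 a4]] /=.
by rewrite !sqr_sqrtr ?addr_ge0 ?sqr_ge0//; lra.
Qed.

Lemma pt3_continuous x (P : set 'rV[C]_3) : nbhs (pt3 x 1) P ->
  exists2 d : R, 0 < d & forall y, sumnorm (y - x) < d -> P (pt3 y 1).
Proof.
move=> /nbhs_ballP[[d d']] /= /[!ltcE]/= /andP[/eqP -> d0] dP.
exists d => // y yx; apply: dP; split; first by rewrite ltcE /= eqxx.
move=> i j.
have n1 : normc (y.1 - x.1) < d by apply: le_lt_trans yx; rewrite lerDl normc_ge0.
have n2 : normc (y.2 - x.2) < d by apply: le_lt_trans yx; rewrite lerDr normc_ge0.
rewrite /ball /= !mxE distrC normr_normc ltcR; case: j => [[|[|[|//]]] ?] //=.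
by rewrite !subrr expr0n /= addr0 sqrtr0.
Qed.

Lemma within_continuous_pt3 (Om : set 'rV[C]_3) (u : 'rV[C]_3 -> R) x (e : R) :
  {within Om, continuous u} -> Om (pt3 x 1) -> 0 < e ->
  exists2 d : R, 0 < d & forall y, Om (pt3 y 1) -> sumnorm (y - x) < d ->
    `|u (pt3 y 1) - u (pt3 x 1)| < e.
Proof.
move=> /subspace_continuousP cu Ox e0.
have := cu _ Ox [set t | `|t - u (pt3 x 1)| < e].
have h : nbhs (u (pt3 x 1)) [set t | `|t - u (pt3 x 1)| < e].
  by apply/nbhs_realP; exists e.
move=> /(_ h) /pt3_continuous[d d0 dP].
by exists d => // y Oy yx; exact: dP.
Qed.


Lemma usc_sumnorm (phi : C2 -> \bar R) x (c : R) :
  plurisubharmonic [set: C2] phi -> (phi x < c%:E)%E ->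
  exists2 d : R, 0 < d & forall y, sumnorm (y - x) < d -> (phi y < c%:E)%E.
Proof.
move=> [_ usc _] xc.
have /nbhs_sumnormP[d d0 dP] : \forall y \near x, [set: C2] y -> (phi y < c%:E)%E.
  exact: (usc x I c xc).
by exists d => // y /dP; exact.
Qed.

Lemma antipeak_submean (Om : set 'rV[C]_3) u p b (r A al be ga ka : R) :
  strong_antipeak Om u -> 0 < r ->
  (forall l, normc l <= r -> Om (pt3 (p + l *: b) 1)) ->
  (forall t : R, u (pt3 (p + ((r * cos t) +i* (r * sin t)) *: b) 1) <=
     A + al * cos t + be * sin t + ga * (cos t ^+ 2 - sin t ^+ 2)
      + ka * (cos t * sin t)) -> u (pt3 p 1) <= A.
Proof.
move=> [_ cu _ pu _] r0 Or uA.
apply: (@circle_mean_le _ _ Om u (pt3 p 1) (pt3 b 0) r A al be ga ka cu pu r0).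
  by move=> l lr; rewrite -pt3_line; exact: Or.
by move=> t; rewrite -pt3_line.
Qed.

(** The case where the domain contains the slice {zeta = 1}: u is at most half of
    u (0, 0, 1) on large circles of the line w = 0, zeta = 1. *)
Lemma no_antipeak_slice (Om : set 'rV[C]_3) u :
  (forall x, Om (pt3 x 1)) -> ~ strong_antipeak Om u.
Proof.
move=> OmT ap; have [_ _ upos _ lim] := ap.
have u0 := upos _ (OmT 0).
have e0 : 0 < u (pt3 0 1) / 2 by rewrite divr_gt0.
have [M uM] := lim _ e0.
have r0 : 0 < `|M| + 1 by rewrite ltr_wpDl.
have : u (pt3 0 1) <= u (pt3 0 1) / 2.
  apply: (@antipeak_submean Om u 0 (1, 0) (`|M| + 1) _ 0 0 0 0 ap r0) => [l _|t].
    exact: OmT.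
  rewrite !mul0r !addr0; apply: le_trans (ler_norm _) (ltW _).
  apply: uM => //; apply: sqnorm_le_cnorm.
  have -> : sqnorm (0 + (((`|M| + 1) * cos t) +i* ((`|M| + 1) * sin t)) *: (1, 0) : C2)
    = (`|M| + 1) ^+ 2 * (cos t ^+ 2 + sin t ^+ 2).
    by rewrite /sqnorm /=; ring.
  rewrite cos2Dsin2 mulr1 -(real_normK (num_real M)).
  by rewrite ltrXn2r ?nnegrE// ?(ltW r0)// ltrDl.
by rewrite ler_pdivlMr// mulr2n mulrDr mulr1 gerDl leNgt u0.
Qed.

Lemma Psi_lt1 (phi : C2 -> \bar R) (rho : R -> R) x (B K : R) :
  (phi x <= (- K)%:E)%E -> rho `|complex.Re x.1| <= B -> rho `|complex.Im x.1| <= B ->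
  2 * B < K -> (Psi phi rho x < 1%:E)%E.
Proof.
rewrite /Psi; case: (phi x) => [s| |] //=; rewrite ?lte_fin ?expR_lt1// lee_fin; lra.
Qed.

(** Off its poles, phi is finite. *)
Lemma fin_weight (phi : C2 -> \bar R) (E : set C2) x :
  plurisubharmonic [set: C2] phi -> E = [set p | phi p = -oo%E] -> ~ E x ->
  phi x = (fine (phi x))%:E.
Proof.
move=> [/(_ x I) xy _ _] -> /= nx; rewrite fineK// fin_numE.
by rewrite (lt_eqF xy) andbT; apply/eqP.
Qed.

Lemma near_weight (phi : C2 -> \bar R) (E : set C2) x (a b : R) :
  open (~` E) -> C1_on (~` E) (fine \o phi) -> ~ E x ->
  a < fine (phi x) < b ->
  exists2 d : R, 0 < d &
    forall y, sumnorm (y - x) < d -> ~ E y /\ a < fine (phi y) < b.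
Proof.
move=> oE h1 nEx /andP[ax xb]; have [d1 d10 dE] := open_sumnorm_ball oE nEx.
have e0 : 0 < Num.min (fine (phi x) - a) (b - fine (phi x)).
  by rewrite lt_min !subr_gt0 ax.
have [d2 d20 dh] := C1_continuous oE nEx h1 e0.
exists (Num.min d1 d2); first by rewrite lt_min d10.
move=> y; rewrite lt_min => /andP[/dE nEy /dh]; rewrite lt_min => /andP[].
rewrite !ltr_norml => /andP[l1 _] /andP[_ l2]; split => //.
by clear -l1 l2; apply/andP; split; move: l1 l2 => /=; lra.
Qed.

(** The set on which the penalized function is maximized: the closed
    ball of square radius m, between two levels of phi.  It avoids the poles of
    phi. *)
Definition slab (phi : C2 -> \bar R) (m T K : R) : set C2 :=
  [set x | [/\ sqnorm x <= m, ((- T)%:E <= phi x)%E & (phi x <= (- K)%:E)%E]].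

Lemma slab_notin (phi : C2 -> \bar R) m T K x : slab phi m T K x -> phi x <> -oo%E.
Proof.
by move=> [_ Tx _]; apply/eqP; rewrite gt_eqF// (lt_le_trans _ Tx)// ltNyr.
Qed.

Lemma slab_closed (phi : C2 -> \bar R) (E : set C2) m T K x :
  plurisubharmonic [set: C2] phi -> E = [set p | phi p = -oo%E] ->
  open (~` E) -> C1_on (~` E) (fine \o phi) -> ~ slab phi m T K x ->
  exists2 d : R, 0 < d & forall y, sumnorm (y - x) < d -> ~ slab phi m T K y.
Proof.
move=> psh_phi EE oE h1 nx; have [xm|mx] := leP (sqnorm x) m; last first.
  have e0 : 0 < sqnorm x - m by rewrite subr_gt0.
  have [d d0 dP] := sqnorm_continuous x e0.
  exists d => // y /dP; rewrite ltr_norml => /andP[l1 _] [l2 _ _].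
  by clear -l1 l2; lra.
have [xT|Tx] := ltP (phi x) (- T)%:E.
  have [d d0 dP] := usc_sumnorm psh_phi xT.
  by exists d => // y /dP yT [_ Ty _]; move: (lt_le_trans yT Ty); rewrite ltxx.
have [xK|Kx] := leP (phi x) (- K)%:E; first by case: nx.
have nEx : ~ E x by rewrite EE /= => xN; rewrite xN in Kx.
have Kh : - K < fine (phi x) < fine (phi x) + 1.
  by rewrite -lte_fin -(fin_weight psh_phi EE nEx) Kx/= ltrDl.
have [d d0 dP] := near_weight oE h1 nEx Kh.
exists d => // y /dP[nEy /andP[Ky _]] [_ _].
by rewrite (fin_weight psh_phi EE nEy) lee_fin leNgt Ky.
Qed.

(** The global step: the constants of W = v + de sqnorm + eta h - la e^h are chosen
    so that the maximum of W on the slab lies in its interior. *)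
Lemma no_antipeak_boundary_pole (phi : C2 -> \bar R) (E : set C2) (rho : R -> R) u p0 :
  plurisubharmonic [set: C2] phi -> E = [set p | phi p = -oo%E] ->
  open (~` E) -> pluriharmonic (~` E) (fine \o phi) ->
  (forall M : R, 0 <= M -> exists B : R, forall t : R, 0 <= t <= M -> rho t <= B) ->
  E p0 -> (forall d : R, 0 < d -> exists2 q, ~ E q & sumnorm (q - p0) < d) ->
  ~ strong_antipeak (Omega_Psi phi rho) u.
Proof.
pose h := fine \o phi; pose Om := Omega_Psi phi rho.
rewrite -/h -/Om.
move=> psh_phi EE oE plh rho_bd Ep0 bd ap.
have [/ex_strict_bound_gt0[B B0 uB] cu upos _ lim] := ap.
pose v x := u (pt3 x 1).
have phip0 : phi p0 = -oo%E by move: Ep0; rewrite EE.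
have Op0 : Om (pt3 p0 1).
  apply/Omega_Psi_pt3; rewrite /Psi phip0 /=; exact: lte01.
(* W will exceed 2 e at some point of the slab and be at most 2 e on its faces *)
set e := v p0 / 4.
have e0 : 0 < e by rewrite divr_gt0// upos.
have v4 : v p0 = 4 * e by rewrite /e; field.
have [M uM] := lim e e0.
(* v is less than e where sqnorm = m, and p0 is well inside *)
pose m := M ^+ 2 + sqnorm p0 + 1.
have sq0 x : 0 <= sqnorm x by rewrite !addr_ge0 ?sqr_ge0.
have m1 : 1 <= m by rewrite /m lerDr addr_ge0 ?sqr_ge0.
have mM : M ^+ 2 < m by rewrite /m -addrA ltrDl ltr_wpDl.
have mp0 : sqnorm p0 + 1 <= m by rewrite /m; move: (sqr_ge0 M); clear; lra.
have m0 : 0 < m by apply: lt_le_trans m1.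
pose de := e / m; have de0 : 0 < de by rewrite divr_gt0.
have dem x : sqnorm x <= m -> de * sqnorm x <= e.
  by move=> xm; rewrite /de mulrAC ler_pdivrMr// ler_pM2l.
have [Rb rhoRb] : exists B : R, forall t : R, 0 <= t <= m + 1 -> rho t <= B.
  by apply: rho_bd; rewrite addr_ge0// ltW.
(* Psi < 1 in the ball as soon as phi <= - K *)
pose K := 2 * `|Rb| + 1.
have K0 : 0 < K by rewrite ltr_wpDl// mulr_ge0.
have KR : 2 * Rb < K by rewrite /K; have := ler_norm Rb; clear; lra.
have Om_of x : sqnorm x <= m -> (phi x <= (- K)%:E)%E -> Om (pt3 x 1).
  move=> /sqnorm_box[x1 x2 _ _] xK; apply/Omega_Psi_pt3.
  by apply: Psi_lt1 xK _ _ KR; apply: rhoRb; apply/andP; split.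
(* on the face phi = - K, the term la e^phi exceeds v + de sqnorm *)
pose la := (B + e) * expR K.
have la0 : 0 < la by rewrite mulr_gt0 ?expR_gt0// addr_gt0.
have laK : la * expR (- K) = B + e by rewrite expRN mulfK// gt_eqF// expR_gt0.
(* below the level - T0, the term la e^phi is at most e / 2 *)
pose T0 := K + 2 * la / e.
have l2 : 0 < 2 * la / e by rewrite divr_gt0// mulr_gt0.
have T0K : K <= T0 by rewrite /T0 lerDl ltW.
have T00 : 0 < T0 by apply: lt_le_trans T0K.
have laT0 (s : R) : s <= - T0 -> la * expR s <= e / 2.
  move=> sT; apply: (@le_trans _ _ (la * expR (- T0))).
    by rewrite ler_pM2l// ler_expR.
  rewrite expRN ler_pdivrMr ?expR_gt0//.
  have h1 : 2 * la / e <= expR T0.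
    by apply: le_trans (expR_ge1Dx T0); rewrite /T0; clear -K0; lra.
  move: h1; rewrite ler_pdivrMr//; clear; lra.
have [p' nEp' [p'T p'm vp']] : exists2 p', ~ E p' &
    [/\ (phi p' < (- T0)%:E)%E, sqnorm p' <= m & v p' > 7 / 2 * e].
  have p0T : (phi p0 < (- T0)%:E)%E by rewrite phip0 ltNyr.
  have [d1 d10 h1] := usc_sumnorm psh_phi p0T.
  have [d2 d20 h2] := sqnorm_continuous p0 ltr01.
  have e20 : 0 < e / 2 by rewrite divr_gt0.
  have [d3 d30 h3] := within_continuous_pt3 cu Op0 e20.
  have [|p' nE] := bd (Num.min d1 (Num.min d2 d3)); first by rewrite !lt_min d10 d20.
  rewrite !lt_min => /andP[/h1 pT /andP[/h2 pm pd]].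
  have sm : sqnorm p' <= m.
    apply: le_trans mp0; move: pm; rewrite ltr_norml => /andP[_]; clear; lra.
  exists p' => //; split => //.
  have /h3/(_ pd) : Om (pt3 p' 1).
    by apply: Om_of => //; apply: (le_trans (ltW pT)); rewrite lee_fin lerN2.
  rewrite -/(v p') -/(v p0) v4 ltr_norml => /andP[+ _]; clear; lra.
have hp' : h p' < - T0 by rewrite -lte_fin -(fin_weight psh_phi EE nEp').
pose T1 := - h p'.
have T10 : 0 < T1 by rewrite /T1; move: hp' T00; clear; lra.
(* the term eta phi costs only e / 2 at p' *)
pose eta := e / (2 * T1).
have eta0 : 0 < eta by rewrite divr_gt0// mulr_gt0.
have etaT1 : eta * h p' = - (e / 2).
  have -> : h p' = - T1 by rewrite opprK.
  by rewrite /eta; field; rewrite gt_eqF.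
(* on the face phi = - T, the term eta phi outweighs v + de sqnorm *)
pose T := T1 + (B + e) / eta.
have BT0 : 0 < (B + e) / eta by rewrite divr_gt0// addr_gt0.
have etaT : B + e <= eta * T.
  have -> : eta * T = eta * T1 + (B + e).
    by rewrite /T mulrDr; congr (_ + _); rewrite mulrC divfK// gt_eqF.
  by rewrite lerDr ltW// mulr_gt0.
pose W x := v x + de * sqnorm x + eta * h x - la * expR (h x).
have Wp' : 2 * e < W p'.
  have := laT0 _ (ltW hp'); have : 0 <= de * sqnorm p' by rewrite mulr_ge0 ?(ltW de0).
  move: vp' e0; rewrite /W etaT1; clear; lra.
have slabOm x : slab phi m T K x -> Om (pt3 x 1) by move=> [? _ ?]; exact: Om_of.
have slabp' : slab phi m T K p'.
  split => //; rewrite (fin_weight psh_phi EE nEp') lee_fin.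
    by rewrite -[leRHS]opprK lerN2 /T lerDl ltW.
  by apply: (le_trans (ltW hp')); rewrite lerN2.
have [x xA xmax] : exists2 x, slab phi m T K x & forall y, slab phi m T K y -> W y <= W x.
  apply: (@attains_max _ _ m).
  - by exists p'.
  - by move=> x [].
  - by move=> x; exact: (slab_closed psh_phi EE oE plh.1.1).
  move=> x xA; have nEx : ~ E x by rewrite EE; exact: slab_notin xA.
  have cv : v y @[y --> within (slab phi m T K) (nbhs x)] --> v x.
    apply: cvg_within_sumnorm => t t0.
    have [d d0 dP] := within_continuous_pt3 cu (slabOm _ xA) t0.
    by exists d => // y /slabOm; exact: dP.
  have cs : sqnorm y @[y --> within (slab phi m T K) (nbhs x)] --> sqnorm x.
    apply: cvg_within_sumnorm => t t0.
    have [d d0 dP] := sqnorm_continuous x t0.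
    by exists d => // y _; exact: dP.
  have ch : h y @[y --> within (slab phi m T K) (nbhs x)] --> h x.
    apply: cvg_within_sumnorm => t t0.
    have [d d0 dP] := C1_continuous oE nEx plh.1.1 t0.
    by exists d => // y _; exact: dP.
  have ce : expR (h y) @[y --> within (slab phi m T K) (nbhs x)] --> expR (h x).
    by apply: continuous_cvg ch; exact: continuous_expR.
  by apply: cvgB; [apply: cvgD; [apply: cvgD => //|]|]; exact: cvgMr.
have nEx : ~ E x by rewrite EE; exact: (slab_notin xA).
have [xm xT xK] := xA.
have Wx : 2 * e < W x by apply: lt_le_trans (xmax _ slabp').
have vB : v x < B by apply: le_lt_trans (ler_norm _) (uB _ (slabOm _ xA)).
have dex := dem x xm.
have lax : 0 < la * expR (h x) by rewrite mulr_gt0 ?expR_gt0.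
rewrite (fin_weight psh_phi EE nEx) !lee_fin in xT xK.
have etax : eta * h x <= 0 by rewrite pmulr_rle0// (le_trans xK)// oppr_le0 ltW.
have {}xm : sqnorm x < m.
  rewrite lt_neqAle xm andbT; apply/eqP => xE.
  have ve : v x < e.
    apply: le_lt_trans (ler_norm _) (uM _ (slabOm _ xA) _).
    by apply: sqnorm_le_cnorm; rewrite xE.
  move: Wx ve dex lax etax; rewrite /W; clear; lra.
have {}xK : h x < - K.
  rewrite lt_neqAle xK andbT; apply/eqP => xE.
  move: Wx vB dex etax e0; rewrite /W xE laK; clear; lra.
have {}xT : - T < h x.
  rewrite lt_neqAle xT andbT; apply/eqP => xE.
  move: Wx vB dex lax etaT e0; rewrite /W -xE mulrN; clear; lra.
have [d1 d10 h1] : exists2 d : R, 0 < d & forall y, sumnorm (y - x) < d ->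
    ~ E y /\ - T < h y < - K by apply: (near_weight oE plh.1.1 nEx); rewrite xT.
have mx0 : 0 < m - sqnorm x by rewrite subr_gt0.
have [d2 d20 h2] := sqnorm_continuous x mx0.
have d0 : 0 < Num.min d1 d2 by rewrite lt_min d10.
apply: (@penalized_no_local_max _ (~` E) (fun y => Om (pt3 y 1)) v h x de eta la _
  oE nEx plh.1 (fun b => plh.2 x b nEx) _ de0 (ltW la0) d0).
  by move=> b r A al be ga ka r0; exact: antipeak_submean.
move=> y; rewrite lt_min => /andP[/h1[nEy /andP[yT yK]] /h2 ym].
have yA : slab phi m T K y.
  split; [|by rewrite (fin_weight psh_phi EE nEy) lee_fin ltW..].
  by move: ym; rewrite ltr_norml => /andP[_]; clear; lra.
by split; [exact: slabOm|exact: xmax].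
Qed.

End Antipeak.

End AntipeakTheory.

Theorem corollary2 (R : realType)
  (eps r : nat -> R)
  (g : forall k : nat, 'I_(2 ^ k.-1) -> R[i] -> R[i])
  (phi : R[i] * R[i] -> \bar R)
  (A : pseudoPMetricType R) (F : R[i] -> A -> R[i] -> R[i])
  (q0 : nat) (q delta qt : nat -> R) (rho : R -> R) :
  let E := wermer_set eps in
  let c := c_ q0 q qt in
  decreasing_to0 eps ->
  wermer_limits_exist eps ->
  plurisubharmonic [set: R[i] * R[i]] phi ->
  E = [set p | phi p = -oo%E] ->
  pluriharmonic (~` E) (fine \o phi) ->
  cantor_like A ->
  graph_family E F ->
  alpha F n @[n --> \oo] --> 0%E ->
  is_q0 (alpha F) q0 ->
  inductive_choice eps r g ->
  (forall n, (1 <= n)%N ->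
    sublevel_in_fattening phi E n (q n) (kappa_strip eps r n)) ->
  (forall n, (q0 < n)%N ->
    [/\ 0 < delta n,
        forall k, (n - 1 <= k <= n + 2)%N ->
          (beta E k (delta n) <= (1 / 2)%:E)%E,
        q n <= qt n &
        sublevel_in_fattening phi E n (qt n) (delta n)]) ->
  (forall n, (1 <= n)%N -> 0 < c n) ->
  (forall m n, (1 <= m <= n)%N -> c m <= c n) ->
  convex_weight c rho ->
  ~ exists u : 'rV[R[i]]_3 -> R, strong_antipeak (Omega_Psi phi rho) u.
Proof.
move=> E c _ lim psh_phi EE plh _ gf _ _ _ _ _ _ _ cw [u ap].
have clE p : ~ E p ->
    exists2 d : R, 0 < d & forall q, sumnorm (q - p) < d -> ~ E q.
  move=> nEp; apply: contrapT => nd; apply: nEp.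
  apply: (wermer_set_closed lim) => d d0; apply: contrapT => nq.
  apply: nd; by exists d => // y yp Ey; apply: nq; exists y.
have oE : open (~` E) by apply: open_sumnormP => x; exact: clE.
have [ET|nET] := pselect (forall p, E p).
  apply: (no_antipeak_slice _ ap) => x; apply/Omega_Psi_pt3.
  have : E x by exact: ET.
  by rewrite EE /Psi /= => -> /=; exact: lte01.
have [p Ep bd] := exists_boundary_point clE (graph_family_nonempty gf) nET.
apply: (no_antipeak_boundary_pole psh_phi EE oE plh _ Ep bd ap) => M M0.
exact: (convex_weight_bounded cw M0).
Qed.
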